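(* Let $k$ be a field, let $K/k(t)$ be a function field, let $\phi\in K(z)$ be non-isotrivial of degree $d\geq2$, and assume that $\gamma\in\mathbb{P}^1(K)$ is not a post-critical point for $\phi$. Then there exists $M$ such that for all $m\geq M$ and all $\alpha\in\phi^{-m}(\gamma)$ (preimages in $\mathbb{P}^1(\overline{K})$), at least one of the following holds: (1) the algebraic degree $d(\alpha)=[K(\alpha):K]$ satisfies $d(\alpha)\leq d^m/2$; (2) there exist distinct $\mathrm{Gal}(K^{\mathrm{sep}}/K)$-conjugates $\alpha_1,\alpha_2,\alpha_3,\alpha_4$ of $\alpha$ such that the cross-ratio $(\alpha_1,\alpha_2;\alpha_3,\alpha_4)$ is not in $\overline{k}$.
   Context: $K$ is a finite extension of the rational function field $k(t)$. $\phi$ is isotrivial if some degree-one change of coordinates $\mu$ over $\overline{K}$ makes $\mu\circ\phi\circ\mu^{-1}$ have coefficients in $\overline{k}$; otherwise non-isotrivial. A point $c\in\mathbb{P}^1(\overline{K})$ is critical for $\phi$ if its ramification index $e_\phi(c)>1$, and $\gamma$ is post-critical if $\gamma=\phi^n(c)$ for some critical point $c$ and some $n\geq1$. The cross-ratio of distinct $x_1,x_2,x_3,x_4$ is $(x_1,x_2;x_3,x_4)=\frac{(x_1-x_4)(x_2-x_3)}{(x_1-x_3)(x_2-x_4)}$ (with the usual convention when a point is $\infty$). *)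

(* Defs.v *)
From HB Require Import structures.
From mathcomp Require Import all_boot all_order all_algebra all_field.

Set Implicit Arguments.
Unset Strict Implicit.
Unset Printing Implicit Defensive.

Import GRing.Theory.
Local Open Scope ring_scope.
Local Open Scope quotient_scope.

(** * Rational functions over a field *)

Notation ratfun F := {fraction {poly F}}.

Definition frac_of (F : fieldType) (p : {poly F}) : ratfun F := tofrac p.

(* [repr f] is some numerator/denominator pair for [f], not necessarily in
   lowest terms; [ratnum f] and [ratden f] are coprime. *)
Definition ratnum (F : fieldType) (f : ratfun F) : {poly F} :=
  \n_(repr f) %/ gcdp \n_(repr f) \d_(repr f).

Definition ratden (F : fieldType) (f : ratfun F) : {poly F} :=
  \d_(repr f) %/ gcdp \n_(repr f) \d_(repr f).

(* [size p] is the degree of [p] plus one. *)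
Definition ratdeg (F : fieldType) (f : ratfun F) : nat :=
  (maxn (size (ratnum f)) (size (ratden f))).-1.

Definition ratconst (F : fieldType) (a : F) : ratfun F := frac_of a%:P.

(* The composite f o g; meaningful unless g is a constant pole of f. *)
Definition ratcomp (F : fieldType) (f g : ratfun F) : ratfun F :=
  (map_poly (@ratconst F) (ratnum f)).[g]
  / (map_poly (@ratconst F) (ratden f)).[g].

Definition ratmap (F E : fieldType) (h : {rmorphism F -> E})
    (f : ratfun F) : ratfun E :=
  frac_of (map_poly h (ratnum f)) / frac_of (map_poly h (ratden f)).

(** * The projective line *)

(* [Some x] is the point [x : 1] and [None] is the point at infinity. *)
Notation P1 F := (option F).

(* At infinity the value is read off the coefficients of degree [ratdeg f]. *)
Definition rateval (F : fieldType) (f : ratfun F) (c : P1 F) : P1 F :=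
  match c with
  | Some x => if (ratden f).[x] == 0 then None
              else Some ((ratnum f).[x] / (ratden f).[x])
  | None => if (ratden f)`_(ratdeg f) == 0 then None
            else Some ((ratnum f)`_(ratdeg f) / (ratden f)`_(ratdeg f))
  end.

(* The order of vanishing at x of f - f(x), or of 1/f if x is a pole of f. *)
Definition ram_index_fin (F : fieldType) (f : ratfun F) (x : F) : nat :=
  if rateval f (Some x) is Some y then mup x (ratnum (f - ratconst y))
  else mup x (ratnum f^-1).

(* At infinity one uses the coordinate 1/z. *)
Definition ram_index (F : fieldType) (f : ratfun F) (c : P1 F) : nat :=
  if c is Some x then ram_index_fin f x
  else ram_index_fin (ratcomp f (frac_of 'X)^-1) 0.

Definition critical (F : fieldType) (f : ratfun F) (c : P1 F) : Prop :=
  (1 < ram_index f c)%N.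

Definition postcritical (F : fieldType) (f : ratfun F) (y : P1 F) : Prop :=
  exists (c : P1 F) (n : nat),
    [/\ critical f c, (1 <= n)%N & y = iter n (rateval f) c].

(* The last case only concerns quadruples that are not distinct. *)
Definition cross_ratio (F : fieldType) (x1 x2 x3 x4 : P1 F) : F :=
  match x1, x2, x3, x4 with
  | Some y1, Some y2, Some y3, Some y4 =>
      ((y1 - y4) * (y2 - y3)) / ((y1 - y3) * (y2 - y4))
  | None, Some y2, Some y3, Some y4 => (y2 - y3) / (y2 - y4)
  | Some y1, None, Some y3, Some y4 => (y1 - y4) / (y1 - y3)
  | Some y1, Some y2, None, Some y4 => (y1 - y4) / (y2 - y4)
  | Some y1, Some y2, Some y3, None => (y2 - y3) / (y1 - y3)
  | _, _, _, _ => 0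
  end.

(** * Algebraic degree and Galois conjugates over [K], inside [L] *)

Definition in_adjoin (K L : fieldType) (iota : {rmorphism K -> L})
    (alpha : P1 L) (x : L) : Prop :=
  match alpha with
  | Some a => exists p q : {poly K},
      (map_poly iota q).[a] != 0
      /\ x = (map_poly iota p).[a] / (map_poly iota q).[a]
  | None => exists c : K, x = iota c
  end.

(* [K(alpha) : K] = n, i.e. K(alpha) has a K-basis with n elements. *)
Definition alg_degree (K L : fieldType) (iota : {rmorphism K -> L})
    (alpha : P1 L) (n : nat) : Prop :=
  exists b : 'I_n -> L,
    (forall i, in_adjoin iota alpha (b i)) /\
    (forall x, in_adjoin iota alpha x ->
       exists! c : 'rV[K]_n, x = \sum_(i < n) iota (c 0 i) * b i).

Definition in_sep (K L : fieldType) (iota : {rmorphism K -> L}) (x : L) :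
    Prop :=
  exists2 p : {poly K}, separable_poly p & root (map_poly iota p) x.

(* sigma restricts to a K-automorphism of the separable closure of K in L;
   its values elsewhere are irrelevant. *)
Definition in_Gal_sep (K L : fieldType) (iota : {rmorphism K -> L})
    (sigma : L -> L) : Prop :=
  [/\ forall x, in_sep iota x -> in_sep iota (sigma x),
      forall y, in_sep iota y -> exists2 x, in_sep iota x & sigma x = y,
      forall x y, in_sep iota x -> in_sep iota y ->
        sigma (x + y) = sigma x + sigma y,
      forall x y, in_sep iota x -> in_sep iota y ->
        sigma (x * y) = sigma x * sigma y
    & forall c : K, sigma (iota c) = iota c].

Definition Gal_conjugate (K L : fieldType) (iota : {rmorphism K -> L})
    (alpha beta : P1 L) : Prop :=
  (forall a, alpha = Some a -> in_sep iota a) /\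
  (exists2 sigma, in_Gal_sep iota sigma & beta = omap sigma alpha).

(** * Constants and isotriviality

  [K] is a finite extension of k(t) = [ratfun k] and [L] an algebraic closure
  of [K], so that the elements of [L] algebraic over [k] form an algebraic
  closure of [k]. *)

Definition const_emb (k : fieldType) (K : fieldExtType (ratfun k))
    (L : fieldType) (iota : {rmorphism K -> L}) (a : k) : L :=
  iota (ratconst a)%:A.

Definition in_kbar (k : fieldType) (K : fieldExtType (ratfun k))
    (L : fieldType) (iota : {rmorphism K -> L}) (x : L) : Prop :=
  algebraicOver (const_emb iota) x.

Definition ratfun_over (L : fieldType) (S : L -> Prop) (f : ratfun L) : Prop :=
  exists p q : {poly L},
    [/\ forall i, S p`_i, forall i, S q`_i, q != 0
      & f = frac_of p / frac_of q].

Definition isotrivial (k : fieldType) (K : fieldExtType (ratfun k))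
    (L : fieldType) (iota : {rmorphism K -> L}) (phi : ratfun K) : Prop :=
  exists mu nu : ratfun L,
    [/\ ratdeg mu = 1%N,
        ratcomp mu nu = frac_of 'X, ratcomp nu mu = frac_of 'X
      & ratfun_over (in_kbar iota)
          (ratcomp (ratcomp mu (ratmap iota phi)) nu)].

Definition is_algebraic_closure (K : fieldType) (L : closedFieldType)
    (iota : {rmorphism K -> L}) : Prop :=
  forall x : L, algebraicOver iota x.

(* Main.v *)
Require Import Defs.
From HB Require Import structures.
From mathcomp Require Import all_boot all_order all_algebra all_field.
From mathcomp Require boolp classical_sets.
From mathcomp Require Import ring.

Set Implicit Arguments.
Unset Strict Implicit.
Unset Printing Implicit Defensive.

Import GRing.Theory.
Local Open Scope ring_scope.

(** Write [L] for the algebraic closure of [K] and [kbar] for the constants of [L].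
    Suppose that [m >= 6], that [alpha] has more than [d ^ m / 2] conjugates and that
    all cross-ratios of four conjugates are constant.  The images [T_i] of the orbit
    of [alpha] under the [i]-th iterate are Galois orbits, and every point of
    [T_(i+1)] has [e > d / 2] preimages in [T_i].  If some coordinate makes [T_i]
    constant, then the cross-ratios of [T_(i+1)] are constant too: four points of
    [T_(i+1)] with cross-ratio [lam] give a nonzero solution of a linear system over
    [kbar] depending linearly on [lam], and since [2 e > d] the system has no nonzero
    solution at [lam = 1], so [lam] is algebraic over [kbar].  Hence there are
    coordinates [mu_0, ..., mu_4] on the line such that every
    [mu_(i+1) o phi o mu_i^-1] maps many constant points to constant points, and is
    therefore defined over [kbar].

    Let [X_i] be the set of points that are constant in the coordinate [mu_i].  Then
    [phi^-1 (X_(i+1)) = X_i], and the critical points of [phi] (which is separable, as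
    [gamma] is not post-critical) lie in every [X_i].  If [X_0] and [X_1] share three
    points they coincide, and conjugation by [mu_0] makes [phi] constant.  Otherwise a
    critical point has a backward orbit of at most two points: either [phi] is
    conjugate to [a z^d] or [a z^-d], or it is conjugate to a polynomial.  In the
    latter case the roots of all the Hasse derivatives of positive order would be
    further common points of the [X_i], so these derivatives are constant and the
    polynomial is additive up to a constant; scaling by a nonzero element of its
    kernel and moving a fixed point to [0] makes it constant.  So [phi] is isotrivial
    in all cases. *)

(** * Binary forms *)

(* The form of degree d with dehomogenisation p; meaningful for size p <= d.+1. *)
Definition heval (R : nzRingType) (d : nat) (p : {poly R}) (x y : R) : R :=
  \sum_(i < d.+1) p`_i * x ^+ i * y ^+ (d - i).

(** For two forms of degree [n.+1] this is read as a form of degree [n + n]; its zeros are the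
    ramification points of the quotient [p / q]. *)
Definition wronskian (R : nzRingType) (p q : {poly R}) : {poly R} :=
  p^`() * q - p * q^`().

Section FormsRing.
Variable R : comNzRingType.
Implicit Types (d : nat) (p q g h : {poly R}) (x y u : R).

Lemma hevalD d p q x y : heval d (p + q) x y = heval d p x y + heval d q x y.
Proof.
by rewrite /heval -big_split; apply: eq_bigr => i _; rewrite coefD !mulrDl.
Qed.

Lemma hevalZ d u p x y : heval d (u *: p) x y = u * heval d p x y.
Proof. by rewrite /heval mulr_sumr; apply: eq_bigr => i _; rewrite coefZ !mulrA. Qed.

Lemma heval0 d x y : heval d 0 x y = 0.
Proof. by rewrite -(scale0r 0) hevalZ mul0r. Qed.

Lemma hevalB d p q x y : heval d (p - q) x y = heval d p x y - heval d q x y.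
Proof. by rewrite -scaleN1r hevalD hevalZ mulN1r. Qed.

Lemma heval_y1 d p x : (size p <= d.+1)%N -> heval d p x 1 = p.[x].
Proof.
move=> sp; rewrite (horner_coef_wide _ sp); apply: eq_bigr => i _.
by rewrite expr1n mulr1.
Qed.

Lemma heval_y0 d p x : heval d p x 0 = p`_d * x ^+ d.
Proof.
rewrite /heval big_ord_recr /= subnn mulr1 big1 ?add0r // => i _.
by rewrite expr0n subn_eq0 leqNgt ltn_ord mulr0.
Qed.

Lemma heval_scale d p u x y : heval d p (u * x) (u * y) = u ^+ d * heval d p x y.
Proof.
rewrite /heval mulr_sumr; apply: eq_bigr => i _.
have -> : u ^+ d = u ^+ i * u ^+ (d - i) by rewrite -exprD subnKC // -ltnS.
by rewrite !exprMn; ring.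
Qed.

Lemma heval_MXaddC d p x y u :
  heval d.+1 (p * 'X + u%:P) x y = x * heval d p x y + u * y ^+ d.+1.
Proof.
rewrite /heval big_ord_recl /= coefD coefMX coefC /= add0r mulr1 subn0 addrC.
congr (_ + _); rewrite mulr_sumr; apply: eq_bigr => i _.
by rewrite coefD coefMX coefC /= addr0 subSS exprS; ring.
Qed.

Lemma heval_XM d p x y : heval d.+1 ('X * p) x y = x * heval d p x y.
Proof. by rewrite mulrC -[_ * 'X]addr0 heval_MXaddC mul0r addr0. Qed.

Lemma heval_C d u x y : heval d u%:P x y = u * y ^+ d.
Proof.
rewrite /heval big_ord_recl /= coefC /= subn0 mulr1 big1 ?addr0 // => i _.
by rewrite coefC /= !mul0r.
Qed.

Lemma heval_raise a d p x y :
  (size p <= d.+1)%N -> heval (a + d) p x y = y ^+ a * heval d p x y.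
Proof.
move=> sp; rewrite /heval mulr_sumr.
rewrite -!(big_mkord xpredT (fun i => p`_i * x ^+ i * y ^+ (_ - i))).
rewrite -(big_mkord xpredT (fun i => y ^+ a * (p`_i * x ^+ i * y ^+ (d - i)))).
rewrite (big_cat_nat (n := d.+1)) //= ?ltnS ?leq_addl //.
rewrite [X in _ + X]big_nat [X in _ + X]big1 => [|i /andP[di _]]; last first.
  by rewrite nth_default ?mul0r // (leq_trans sp).
rewrite addr0; apply: eq_big_nat => i /andP[_ id].
by rewrite -addnBA // exprD; ring.
Qed.

Lemma hevalM a b p q x y : (size p <= a.+1)%N -> (size q <= b.+1)%N ->
  heval (a + b) (p * q) x y = heval a p x y * heval b q x y.
Proof.
move=> sp sq; elim/poly_ind: p a sp => [|p c IHp] a sp.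
  by rewrite mul0r !heval0 mul0r.
case: a sp => [|a] sp.
  have -> : p = 0.
    apply/eqP; rewrite -size_poly_eq0.
    move: sp; rewrite size_MXaddC; case: ifP => [/andP[/eqP-> _]|_]; rewrite ?size_poly0 //.
    by rewrite ltnS leqn0.
  by rewrite mul0r add0r mul_polyC hevalZ heval_C expr0 mulr1.
have sp' : (size p <= a.+1)%N.
  by move: sp; rewrite size_MXaddC; case: ifP => [/andP[/eqP-> _]|_]; rewrite ?size_poly0.
rewrite mulrDl -mulrA ['X * q]mulrC mulrA mul_polyC hevalD hevalZ (heval_raise _ _ _ sq).
rewrite heval_MXaddC addSn.
by rewrite [p * q * _]mulrC heval_XM IHp //; ring.
Qed.

Lemma horner_heval d p g h x :
  (heval d (map_poly polyC p) g h).[x] = heval d p g.[x] h.[x].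
Proof.
rewrite /heval horner_sum; apply: eq_bigr => i _.
by rewrite coef_map /= -mulrA !hornerM hornerC !horner_exp mulrA.
Qed.

Lemma size_heval d p g h : (size g <= 2)%N -> (size h <= 2)%N ->
  (size (heval d (map_poly polyC p) g h) <= d.+1)%N.
Proof.
move=> sg sh; apply: (leq_trans (size_sum _ _ _)); apply/bigmax_leqP => i _.
have sX (r : {poly R}) n : (size r <= 2)%N -> (size (r ^+ n) <= n.+1)%N.
  move=> sr; apply: (leq_trans (size_poly_exp_leq _ _)).
  by rewrite ltnS -[leqRHS]mul1n leq_mul2r -subn1 leq_subLR sr orbT.
rewrite coef_map /= -mulrA mul_polyC (leq_trans (size_scale_leq _ _)) //.
apply: (leq_trans (size_polyMleq _ _)).
rewrite -subn1 leq_subLR add1n.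
have -> : d.+2 = (i.+1 + (d - i).+1)%N by rewrite addSn addnS subnKC // -ltnS.
by rewrite leq_add ?sX.
Qed.

(** Chain rule [H(g, h)' = H_x g' + H_y h'] for the form [H] of [p], multiplied by [g * h]: then
    only [x H_x], the form of X p', and [y H_y = d H - x H_x] (Euler) occur, and no form of degree
    [d - 1] is involved. *)
Lemma heval_deriv d p g h : (size p <= d.+1)%N ->
  g * h * (heval d (map_poly polyC p) g h)^`() =
  heval d (map_poly polyC ('X * p^`())) g h * (g^`() * h)
  + (heval d (map_poly polyC p) g h *+ d
     - heval d (map_poly polyC ('X * p^`())) g h) * (g * h^`()).
Proof.
move=> sp; rewrite /heval raddf_sum !mulr_sumr -sumrMnl -sumrB !mulr_suml -big_split.
apply: eq_bigr => i _ /=; rewrite !coef_map /= coefXM coef_deriv.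
have -> : (if i == 0 :> nat then 0 else p`_i.-1.+1 *+ i.-1.+1) = p`_i *+ i.
  by case: (i : nat) => [|j] /=; rewrite ?mulr0n.
set a := (i : nat); have ad : (a <= d)%N by rewrite -ltnS ltn_ord.
have dE : d%:R = a%:R + (d - a)%:R :> {poly R} by rewrite -natrD subnKC.
have E (r : {poly R}) n : r * (r ^+ n)^`() = r^`() * r ^+ n * n%:R.
  rewrite deriv_exp; case: n => [|n]; first by rewrite !mulr0.
  by rewrite /= mulr_natr mulrnAr; congr (_ *+ _); rewrite exprS mulrCA !mulrA.
rewrite rmorphMn /= -(mulr_natr (p`_a)%:P) -[_ *+ d]mulr_natr dE.
rewrite -[X in X^`()]mulrA derivM derivC mul0r add0r derivM.
move: (E g a) (E h (d - a)%N); move: (g ^+ a)^`() (h ^+ (d - a))^`().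
move: (g ^+ a) (h ^+ (d - a)) g^`() h^`() (p`_a)%:P a%:R (d - a)%:R.
move=> G H g' h' c n m G' H' EG EH.
transitivity (c * ((g * G') * H * h + G * (h * H') * g)); first by ring.
by rewrite EG EH; ring.
Qed.

End FormsRing.

Lemma heval_map (R S : comNzRingType) (f : {rmorphism R -> S}) d p x y :
  f (heval d p x y) = heval d (map_poly f p) (f x) (f y).
Proof.
rewrite /heval rmorph_sum; apply: eq_bigr => i _.
by rewrite !rmorphM !rmorphXn coef_map.
Qed.

Section FormsDomain.
Variable R : idomainType.
Implicit Types (p q g h : {poly R}).

Lemma coefM_top a b p q : (size p <= a.+1)%N -> (size q <= b.+1)%N ->
  (p * q)`_(a + b) = p`_a * q`_b.
Proof.
move=> sp sq; have := hevalM 1 0 sp sq.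
by rewrite !heval_y0 !expr1n !mulr1.
Qed.

Lemma size_deriv_leq n p : (size p <= n.+1)%N -> (size p^`() <= n)%N.
Proof.
move=> sp; have [->|p0] := eqVneq p 0; first by rewrite deriv0 size_poly0.
by rewrite -ltnS (leq_trans (lt_size_deriv p0)).
Qed.

(** The coefficient of degree [n + n.+1] is, in both terms, [n.+1] times the product of the two top
    coefficients, so it cancels. *)
Lemma size_wronskian n p q : (size p <= n.+2)%N -> (size q <= n.+2)%N ->
  (size (wronskian p q) <= (n + n).+1)%N.
Proof.
move=> sp sq; have sp' := size_deriv_leq sp; have sq' := size_deriv_leq sq.
apply/leq_sizeP => i; rewrite leq_eqVlt => /orP[/eqP<-|ni]; rewrite coefB.
  rewrite -addnS (coefM_top sp' sq) addnS -addSn (coefM_top sp sq').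
  by rewrite !coef_deriv mulrnAl mulrnAr subrr.
have sz (r s : {poly R}) : (size r <= n.+1)%N -> (size s <= n.+2)%N -> (r * s)`_i = 0.
  move=> sr ss; rewrite nth_default // (leq_trans (size_polyMleq _ _)) //.
  rewrite -subn1 leq_subLR add1n (leq_trans (leq_add sr ss)) //.
  by rewrite addSn !addnS ltnS.
by rewrite sz // mulrC sz // subrr.
Qed.

(* Chain rule for the ramification form of a map given by two forms of degree n.+1. *)
Lemma wronskian_heval n p q g h : (size p <= n.+2)%N -> (size q <= n.+2)%N ->
  wronskian (heval n.+1 (map_poly polyC p) g h) (heval n.+1 (map_poly polyC q) g h)
  = heval (n + n) (map_poly polyC (wronskian p q)) g h * wronskian g h.
Proof.
move=> sp sq.
have smap (r : {poly R}) m : (size r <= m)%N -> (size (map_poly polyC r) <= m)%N.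
  exact/leq_trans/size_poly.
(* [heval_deriv] carries the factor [g * h]: where it vanishes the identity is computed directly,
   otherwise the factor is cancelled. *)
have [h0|h0] := eqVneq h 0.
  rewrite h0 !heval_y0 /wronskian deriv0 !mulr0 subrr mulr0.
  rewrite !derivM !coef_map /= !derivC; ring.
have [g0|g0] := eqVneq g 0.
  have H0 m r : heval m (map_poly polyC r) 0 h = (r`_0)%:P * h ^+ m.
    elim/poly_ind: r m => [|r c _] m; first by rewrite rmorph0 heval0 coef0 mul0r.
    rewrite rmorphD rmorphM /= map_polyX map_polyC /= coefD coefMX coefC /= add0r.
    case: m => [|m]; last by rewrite heval_MXaddC mul0r add0r.
    by rewrite /heval big_ord1 coefD coefMX coefC /= add0r subnn !expr0 !mulr1.
  rewrite g0 !H0 /wronskian deriv0 !derivM !derivC; ring.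
have gh0 : g * h != 0 by rewrite mulf_neq0.
apply: (mulfI gh0).
set w := wronskian p q.
have sw : (size w <= (n + n).+1)%N by exact: size_wronskian.
have Ew : g * h * heval (n + n) (map_poly polyC w) g h =
    heval (n.+1 + n.+1) (map_poly polyC ('X * w)) g h.
  rewrite addSn addnS -[(n + n).+2]add1n (@heval_raise _ 1 (n + n).+1); last first.
    by apply: smap; apply: (leq_trans (size_polyMleq _ _)); rewrite size_polyX.
  by rewrite rmorphM /= map_polyX heval_XM expr1 -mulrA mulrCA.
have sX (r : {poly R}) : (size r <= n.+2)%N -> (size (map_poly polyC ('X * r^`())) <= n.+2)%N.
  move=> sr; apply: smap; apply: (leq_trans (size_polyMleq _ _)); rewrite size_polyX /=.
  by rewrite ltnS size_deriv_leq.
have Xw : 'X * w = 'X * p^`() * q - p * ('X * q^`()).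
  by rewrite /w /wronskian mulrBr; ring.
rewrite [RHS]mulrA Ew Xw rmorphB /= (rmorphM _ ('X * p^`())) (rmorphM _ p) /=.
rewrite hevalB !hevalM ?sX ?smap //.
rewrite /wronskian mulrBr [X in X - _]mulrA [X in _ - X]mulrCA !heval_deriv //.
move: (heval _ _ _ _) (heval _ _ _ _) => A B; move: (heval _ _ _ _) (heval _ _ _ _) => A' B'.
ring.
Qed.

End FormsDomain.

Section FormsField.
Variable F : fieldType.

Lemma heval_div d (p : {poly F}) x y : y != 0 -> (size p <= d.+1)%N ->
  heval d p x y = y ^+ d * p.[x / y].
Proof.
by move=> y0 sp; rewrite -(heval_y1 _ sp) -heval_scale mulr1 mulrCA divff // mulr1.
Qed.

(** Over an algebraically closed field this says that the two forms define a morphism of degree [d]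
    of the projective line. *)
Definition nondeg d (p q : {poly F}) := forall x y,
  heval d p x y = 0 -> heval d q x y = 0 -> x = 0 /\ y = 0.

End FormsField.

Lemma closed_root (L : closedFieldType) (p : {poly L}) :
  (1 < size p)%N -> exists x, root p x.
Proof. by move=> sp; apply/closed_rootP; case: (size p) sp => [|[]]. Qed.

Lemma form_zero (L : closedFieldType) d (p : {poly L}) :
  (0 < d)%N -> (size p <= d.+1)%N ->
  exists x y, heval d p x y = 0 /\ (x, y) != (0, 0).
Proof.
move=> d0 sp; have [pd|pd] := eqVneq p`_d 0.
  by exists 1, 0; rewrite heval_y0 pd mul0r; split=> //; rewrite xpair_eqE oner_eq0.
have [x px] : exists x, root p x.
  by apply: closed_root; apply: (leq_ltn_trans d0); rewrite ltnNge; apply: contra pd => /leq_sizeP->.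
exists x, 1; rewrite heval_y1 //; split; first exact/eqP.
by rewrite xpair_eqE oner_eq0 andbF.
Qed.

Lemma nondeg_coprime (L : closedFieldType) d (p q : {poly L}) :
  (size p <= d.+1)%N -> (size q <= d.+1)%N -> nondeg d p q -> coprimep p q.
Proof.
move=> sp sq H; apply/Pdiv.ClosedField.coprimepP => x px; apply/eqP => qx.
have := H x 1; rewrite !heval_y1 // => /(_ (eqP px) qx)[_ /eqP].
by rewrite oner_eq0.
Qed.

Lemma nondeg_lead (F : fieldType) d (p q : {poly F}) :
  nondeg d p q -> (p`_d != 0) || (q`_d != 0).
Proof.
move=> H; rewrite -negb_and; apply/negP => /andP[/eqP pd /eqP qd].
have := H 1 0; rewrite !heval_y0 pd qd !mul0r => /(_ erefl erefl)[/eqP].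
by rewrite oner_eq0.
Qed.

Lemma coprime_nondeg (F : fieldType) d (p q : {poly F}) :
  maxn (size p) (size q) = d.+1 -> coprimep p q -> nondeg d p q.
Proof.
move=> sz cpq x y.
have sp : (size p <= d.+1)%N by rewrite -sz leq_maxl.
have sq : (size q <= d.+1)%N by rewrite -sz leq_maxr.
have [->|y0] := eqVneq y 0.
  rewrite !heval_y0 => /eqP; rewrite mulf_eq0 => pd /eqP; rewrite mulf_eq0 => qd.
  split=> //; apply/eqP; apply: contraT => x0.
  move: pd qd; rewrite (negPf (expf_neq0 d x0)) !orbF => /eqP pd /eqP qd.
  have drop (r : {poly F}) : r`_d = 0 -> (size r <= d.+1)%N -> (size r <= d)%N.
    move=> rd sr; apply/leq_sizeP => i; rewrite leq_eqVlt => /orP[/eqP<-//|di].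
    by rewrite nth_default // (leq_trans sr).
  have : (maxn (size p) (size q) <= d)%N by rewrite geq_max !drop.
  by rewrite sz ltnn.
rewrite !heval_div // => /eqP; rewrite mulf_eq0 (negPf (expf_neq0 d y0)) /= => px.
move=> /eqP; rewrite mulf_eq0 (negPf (expf_neq0 d y0)) /= => qx.
by have := coprimep_root cpq px; rewrite qx.
Qed.

(** * Linear algebra over an algebraically closed field of constants *)

Section Constants.
Variables (k0 : fieldType) (L : closedFieldType) (j : {rmorphism k0 -> L}).
Hypothesis rel_closed : forall (p : {poly k0}) (x : L),
  p != 0 -> root (map_poly j p) x -> exists c, x = j c.

(** With [R] a right inverse of [N0 + N1] and [A = N1 R], multiplying by [R] turns the equation into
    [B + (lam - 1) B A = 0]. So [-1 / (lam - 1)] is an eigenvalue of a matrix over [k0], a root of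
    its characteristic polynomial. *)
Lemma pencil_const m n (N0 N1 : 'M[k0]_(m, n)) (lam : L) (B : 'rV[L]_m) :
  row_free (N0 + N1) -> B != 0 ->
  B *m (map_mx j N0 + lam *: map_mx j N1) = 0 -> exists c, lam = j c.
Proof.
move=> /row_freeP[R NR] B0 BN.
have [->|lam1] := eqVneq lam 1; first by exists 1; rewrite rmorph1.
have lam0 : lam - 1 != 0 by rewrite subr_eq0.
pose A := map_mx j (N1 *m R).
have N0R : map_mx j (N0 *m R) = 1%:M - A.
  by rewrite -(map_mx1 j) -map_mxB -NR mulmxDl addrK.
have BA : B *m A = - (lam - 1)^-1 *: B.
  have : B *m (map_mx j N0 + lam *: map_mx j N1) *m map_mx j R = 0 by rewrite BN mul0mx.
  rewrite -mulmxA mulmxDl -scalemxAl -!map_mxM N0R -/A mulmxDr mulmxBr mulmx1.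
  rewrite -scalemxAr => E.
  have {}E : (lam - 1) *: (B *m A) = - B.
    by apply/eqP; rewrite scalerBl scale1r -subr_eq0 opprK [_ + B]addrC addrA addrAC E.
  by rewrite scaleNr -scalerN -E scalerA mulVf // scale1r.
have : eigenvalue A (- (lam - 1)^-1).
  by apply/eigenvalueP; exists B.
rewrite eigenvalue_root_char -map_char_poly => /(rel_closed (monic_neq0 (char_poly_monic _)))[c Ec].
exists (1 - c^-1); rewrite rmorphB rmorph1 fmorphV -Ec invrN invrK; ring.
Qed.

Lemma constants_infinite (s : seq k0) : exists c, c \notin s.
Proof.
have sP : size (\prod_(a <- s) ('X - a%:P)) = (size s).+1 by rewrite size_prod_XsubC.
(* The value at a point of [s] is 1, so a root lies outside [s]; the factor ['X] keeps the degree
   positive when [s] is empty. *)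
pose p := 'X * \prod_(a <- s) ('X - a%:P) + 1.
have sz : size p = (size s).+2.
  have sX : size ('X * \prod_(a <- s) ('X - a%:P)) = (size s).+2.
    by rewrite mulrC size_mulX ?sP // -size_poly_eq0 sP.
  by rewrite /p size_polyDl sX // size_poly1.
have [x] : exists x, root (map_poly j p) x.
  by apply: closed_root; rewrite size_map_poly sz.
move=> rx; have [|c Ec] := rel_closed _ rx; first by rewrite -size_poly_eq0 sz.
exists c; apply/negP => cs; move: rx; rewrite Ec rootE horner_map /= fmorph_eq0.
rewrite /p !hornerE; have /rootP-> : root (\prod_(a <- s) ('X - a%:P)) c.
  by rewrite root_prod_XsubC.
by rewrite mulr0 add0r oner_eq0.
Qed.

Lemma constants_uniq n : exists2 s : seq k0, uniq s & size s = n.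
Proof.
elim: n => [|n [s us ss]]; first by exists [::].
by have [c cs] := constants_infinite s; exists (c :: s); rewrite /= ?cs ?us ?ss.
Qed.

(** A Vandermonde matrix: a row of coefficients multiplied by it becomes the row of values at the
    points of [s]. *)
Definition vdm n (s : seq k0) : 'M[k0]_(n, size s) :=
  \matrix_(i, l) (nth 0 s l) ^+ i.

Lemma mul_vdm (E : fieldType) (f : {rmorphism k0 -> E}) n (s : seq k0) (v : 'rV[E]_n) :
  v *m map_mx f (vdm n s) = \row_l (rVpoly v).[f (nth 0 s l)].
Proof.
apply/rowP => l; rewrite !mxE (@horner_coef_wide _ n) ?size_poly //.
by apply: eq_bigr => i _; rewrite !mxE coef_rVpoly_ord rmorphXn.
Qed.

Lemma mul_vdm0 (E : fieldType) (f : {rmorphism k0 -> E}) n (s : seq k0) (v : 'rV[E]_n) :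
  v *m map_mx f (vdm n s) = 0 <-> {in s, forall a, (rVpoly v).[f a] = 0}.
Proof.
rewrite mul_vdm; split=> [/rowP H a /(nthP 0)[i si <-]|H].
  by have := H (Ordinal si); rewrite !mxE.
by apply/rowP => i; rewrite !mxE H // mem_nth.
Qed.

Lemma rVpoly_vanish (E : fieldType) (f : {rmorphism k0 -> E}) n (s : seq k0) (v : 'rV[E]_n) :
  uniq s -> (n <= size s)%N -> {in s, forall a, (rVpoly v).[f a] = 0} -> v = 0.
Proof.
move=> us ns H; rewrite -[v]rVpolyK; have -> : rVpoly v = 0; last by rewrite linear0.
apply: (@roots_geq_poly_eq0 _ _ (map f s)).
- by apply/allP => _ /mapP[a /H/eqP ra ->].
- by rewrite map_inj_uniq //; apply: fmorph_inj.
- by rewrite size_map (leq_trans (size_poly _ _)).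
Qed.

(* At lam = 1 the system has only the zero solution, so its nonzero solutions
   occur for eigenvalues of a constant matrix. *)
Lemma vanishing_pencil_const n (C1 C2 : {poly L}) (lam : L) (s1 s2 s3 s4 : seq k0) :
  (size C1 <= n)%N -> (size C2 <= n)%N -> C2 != 0 ->
  uniq (s1 ++ s2) -> uniq (s3 ++ s4) ->
  (n <= size (s1 ++ s2))%N -> (n <= size (s3 ++ s4))%N ->
  {in s1, forall a, C1.[j a] = 0} -> {in s2, forall a, C2.[j a] = 0} ->
  {in s3, forall a, (C1 + C2).[j a] = 0} ->
  {in s4, forall a, (C1 + lam *: C2).[j a] = 0} ->
  exists c, lam = j c.
Proof.
move=> sC1 sC2 C20 u12 u34 n12 n34 v1 v2 v3 v4.
(* The unknown row is [(C1, C2)]. The column blocks impose the vanishing of [C1] on [s1], [C2] on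
   [s2], [C1 + C2] on [s3] and [C1 + lam C2] on [s4]. *)
pose N0 := row_mx (row_mx (col_mx (vdm n s1) 0) (col_mx 0 (vdm n s2)))
                  (row_mx (col_mx (vdm n s3) (vdm n s3)) (col_mx (vdm n s4) 0)).
pose N1 : 'M_(n + n, (size s1 + size s2) + (size s3 + size s4)) :=
  row_mx 0 (row_mx 0 (col_mx 0 (vdm n s4))).
pose B := row_mx (poly_rV C1 : 'rV_n) (poly_rV C2 : 'rV_n).
apply: (@pencil_const _ _ N0 N1 lam B).
- apply: inj_row_free => v; rewrite -[v]hsubmxK /N0 /N1 !add_row_mx !addr0 !add_col_mx.
  rewrite add0r addr0 !mul_mx_row !mul_row_col !mulmx0 !addr0 !add0r.
  move: (lsubmx v) (rsubmx v) => v1' v2'.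
  move=> /eqP; rewrite -row_mx0 => /eqP/eq_row_mx[].
  rewrite -row_mx0 => /eq_row_mx[E1 E2]; rewrite -row_mx0 => /eq_row_mx[E3 E4].
  have id0 m p (A : 'M[k0]_(m, p)) : map_mx idfun A = A.
    by apply/matrixP => a b; rewrite mxE.
  rewrite -mulmxDl in E3; rewrite -mulmxDl in E4.
  (* At [lam = 1] the sum vanishes on [s3 ++ s4], hence is zero; then [C1 = - C2] vanishes on
     [s1 ++ s2]. *)
  have S0 : v1' + v2' = 0.
    apply: (@rVpoly_vanish _ idfun _ (s3 ++ s4)) => // a.
    by rewrite mem_cat => /orP[]; apply: (mul_vdm0 idfun _ _).1; rewrite id0.
  have V0 : v1' = 0.
    apply: (@rVpoly_vanish _ idfun _ (s1 ++ s2)) => // a.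
    rewrite mem_cat => /orP[]; apply: (mul_vdm0 idfun _ _).1; rewrite id0 //.
    by rewrite (_ : v1' = - v2') ?mulNmx ?E2 ?oppr0 //; apply/eqP; rewrite -addr_eq0 S0.
  by move: S0; rewrite V0 add0r => ->; rewrite row_mx0.
- apply: contraNneq C20; rewrite -row_mx0 => /eq_row_mx[_ E].
  by rewrite -(poly_rV_K sC2) E linear0.
- rewrite /N0 /N1 /B !map_row_mx !map_col_mx !map_mx0 !scale_row_mx !scale_col_mx !scaler0.
  rewrite !add_row_mx !addr0 !add_col_mx addr0 add0r !mul_mx_row !mul_row_col !mulmx0.
  rewrite !addr0 !add0r -scalemxAr scalemxAl -!mulmxDl.
  have rV0 (C : {poly L}) s : (size C <= n)%N -> {in s, forall a, C.[j a] = 0} ->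
      poly_rV C *m map_mx j (vdm n s) = 0.
    by move=> sC HC; apply/mul_vdm0 => a /HC; rewrite poly_rV_K.
  rewrite -linearZ -!linearD /= !rV0 ?row_mx0 //.
    by rewrite (leq_trans (size_polyD _ _)) // geq_max sC1 (leq_trans (size_scale_leq _ _)).
  by rewrite (leq_trans (size_polyD _ _)) // geq_max sC1.
Qed.

(** The members [P - t1 Q] and [P - t2 Q] of the pencil are scaled so that their sum is a multiple
    of [P - t3 Q]; then [C1 + lam C2] is a multiple of [P - t4 Q] exactly when [lam] is the
    cross-ratio. *)
Lemma cross_ratio_const n (P Q : {poly L}) (t1 t2 t3 t4 : L) (s1 s2 s3 s4 : seq k0) :
  (size P <= n)%N -> (size Q <= n)%N ->
  uniq [:: t1; t2; t3; t4] -> P - t2 *: Q != 0 ->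
  uniq (s1 ++ s2) -> uniq (s3 ++ s4) ->
  (n <= size (s1 ++ s2))%N -> (n <= size (s3 ++ s4))%N ->
  {in s1, forall a, P.[j a] = t1 * Q.[j a]} ->
  {in s2, forall a, P.[j a] = t2 * Q.[j a]} ->
  {in s3, forall a, P.[j a] = t3 * Q.[j a]} ->
  {in s4, forall a, P.[j a] = t4 * Q.[j a]} ->
  exists c, ((t1 - t4) * (t2 - t3)) / ((t1 - t3) * (t2 - t4)) = j c.
Proof.
move=> sP sQ /=; rewrite !inE !negb_or => /and4P[/and3P[t12 t13 t14] /andP[t23 t24] t34 _].
move=> R2 u12 u34 n12 n34 H1 H2 H3 H4.
have ne (x y : L) : x != y -> x - y != 0 by rewrite subr_eq0.
have sR u t : (size (u *: (P - t *: Q)) <= n)%N.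
  rewrite (leq_trans (size_scale_leq _ _)) // (leq_trans (size_polyD _ _)) //.
  by rewrite geq_max sP size_polyN (leq_trans (size_scale_leq _ _)).
apply: (@vanishing_pencil_const n ((t2 - t3) *: (P - t1 *: Q)) ((t3 - t1) *: (P - t2 *: Q))
   _ s1 s2 s3 s4) => //.
- by rewrite scaler_eq0 negb_or R2 andbT ne // eq_sym.
- by move=> a /H1; rewrite !hornerE => ->; rewrite subrr mulr0.
- by move=> a /H2; rewrite !hornerE => ->; rewrite subrr mulr0.
- by move=> a /H3; rewrite !hornerE => ->; ring.
- move=> a /H4; rewrite !(hornerD, hornerN, hornerZ) => ->; field.
  by rewrite !ne.
Qed.

(** The conditions [c P = b Q] on [s] are linear over [k0] and have the nonzero solution [(P, Q)]
    over [L], hence a nonzero solution [(P0, Q0)] over [k0]. The products [P0 Q] and [Q0 P] have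
    degree at most [2 d] and agree at more than [2 d] points. As [P] and [Q] are coprime,
    [(P0, Q0) = h (P, Q)], and the degrees make [h] constant. *)
Lemma map_const d (P Q : {poly L}) (s : seq k0) (b c : k0 -> k0) :
  (size P <= d.+1)%N -> (size Q <= d.+1)%N -> nondeg d P Q ->
  uniq s -> (d + d < size s)%N ->
  {in s, forall a, (b a, c a) != (0, 0)} ->
  {in s, forall a, j (c a) * P.[j a] = j (b a) * Q.[j a]} ->
  exists P0 Q0 : {poly k0}, exists2 u : L, u != 0 &
   [/\ (size P0 <= d.+1)%N, (size Q0 <= d.+1)%N,
       P = u *: map_poly j P0 & Q = u *: map_poly j Q0].
Proof.
move=> sP sQ ndPQ us ds bc H.
pose D (e : k0 -> k0) : 'M[k0]_(size s) := diag_mx (\row_l e (nth 0 s l)).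
pose N := col_mx (vdm d.+1 s *m D c) (- (vdm d.+1 s *m D b)).
have evD (E : fieldType) (f : {rmorphism k0 -> E}) e (v : 'rV_d.+1) l :
    (v *m map_mx f (vdm d.+1 s *m D e)) 0 l = (rVpoly v).[f (nth 0 s l)] * f (e (nth 0 s l)).
  by rewrite map_mxM mulmxA mul_vdm /D map_diag_mx mul_mx_diag !mxE.
have : ~~ row_free N.
  rewrite -(row_free_map j); apply/negP => /row_freeP[N' NN'].
  pose B := row_mx (poly_rV P : 'rV_d.+1) (poly_rV Q : 'rV_d.+1).
  have BN : B *m map_mx j N = 0.
    rewrite map_col_mx map_mxN mul_row_col mulmxN; apply/rowP => l.
    rewrite mxE evD [X in _ + X]mxE evD !poly_rV_K // mulrC H ?mem_nth //.
    by rewrite mulrC subrr mxE.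
  have : B = 0 by rewrite -[B]mulmx1 -NN' mulmxA BN mul0mx.
  rewrite -row_mx0 => /eq_row_mx[P0 Q0].
  have := nondeg_lead ndPQ; rewrite -(poly_rV_K sP) -(poly_rV_K sQ) P0 Q0.
  by rewrite !linear0 !coef0 eqxx.
rewrite -kermx_eq0 => /rowV0Pn[v /sub_kermxP vN v0].
pose P0 := rVpoly (lsubmx v : 'rV_d.+1); pose Q0 := rVpoly (rsubmx v : 'rV_d.+1).
have sP0 : (size P0 <= d.+1)%N by apply: size_poly.
have sQ0 : (size Q0 <= d.+1)%N by apply: size_poly.
have H0 a : a \in s -> c a * P0.[a] = b a * Q0.[a].
  move=> /(nthP 0)[l ls <-]; move: vN; rewrite -[v]hsubmxK mul_row_col mulmxN.
  move=> /rowP/(_ (Ordinal ls)); rewrite mxE [X in _ + X]mxE [in RHS]mxE.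
  have := evD _ idfun c (lsubmx v) (Ordinal ls).
  have := evD _ idfun b (rsubmx v) (Ordinal ls).
  have id0 m p (A : 'M[k0]_(m, p)) : map_mx idfun A = A by apply/matrixP => x y; rewrite mxE.
  rewrite !id0 => -> -> /=; rewrite -/P0 -/Q0 => /eqP; rewrite subr_eq0 => /eqP.
  by rewrite mulrC => ->; rewrite mulrC.
have PQ : map_poly j P0 * Q = map_poly j Q0 * P.
  apply/eqP; rewrite -subr_eq0; apply/eqP.
  apply: (@roots_geq_poly_eq0 _ _ (map j s)).
  - apply/allP => _ /mapP[a sa ->]; rewrite rootE !hornerE !horner_map /= subr_eq0.
    have := H a sa; have /(congr1 j) := H0 a sa; rewrite !rmorphM /=.
    have := bc a sa; rewrite xpair_eqE negb_and => /orP[ba|ca] E1 E2.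
      rewrite -(inj_eq (mulfI (_ : j (b a) != 0))) ?fmorph_eq0 //.
      by rewrite mulrCA -E2 [in X in _ == X]mulrA -E1; apply/eqP; ring.
    rewrite -(inj_eq (mulfI (_ : j (c a) != 0))) ?fmorph_eq0 //.
    by rewrite mulrA E1 [in X in _ == X]mulrCA E2; apply/eqP; ring.
  - by rewrite map_inj_uniq //; apply: fmorph_inj.
  - rewrite size_map (leq_trans _ ds) // (leq_trans (size_polyD _ _)) // size_polyN geq_max.
    have sM (A : {poly k0}) (C : {poly L}) : (size A <= d.+1)%N -> (size C <= d.+1)%N ->
        (size (map_poly j A * C)%R <= (d + d).+1)%N.
      move=> sA sC; rewrite (leq_trans (size_polyMleq _ _)) // size_map_poly.
      by rewrite -subn1 leq_subLR (leq_trans (leq_add sA sC)) // addSn addnS.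
    by rewrite !sM.
have /Bezout_eq1_coprimepP[[u w] /= uw] := nondeg_coprime sP sQ ndPQ.
pose h := u * map_poly j P0 + w * map_poly j Q0.
have hP : map_poly j P0 = h * P.
  by rewrite /h mulrDl -(mulrA w) -PQ -[LHS]mul1r -uw; ring.
have hQ : map_poly j Q0 = h * Q.
  by rewrite /h mulrDl -(mulrA u) PQ -[LHS]mul1r -uw; ring.
have h0 : h != 0.
  apply: contraNneq v0 => h0; move: hP hQ; rewrite h0 !mul0r => /eqP + /eqP.
  rewrite !map_poly_eq0 => /eqP P00 /eqP Q00.
  rewrite -[v]hsubmxK -(rVpolyK (lsubmx v)) -(rVpolyK (rsubmx v)) -/P0 -/Q0 P00 Q00.
  by rewrite !linear0 row_mx0.
have sh : (size h <= 1)%N.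
  have key (A : {poly L}) (A0 : {poly k0}) : (size A0 <= d.+1)%N -> A`_d != 0 ->
      map_poly j A0 = h * A -> (size h <= 1)%N.
    move=> sA0 Ad E; have dA : (d < size A)%N.
      by rewrite ltnNge; apply: contra Ad => /leq_sizeP->.
    have A1 : A != 0 by rewrite -size_poly_gt0 (leq_ltn_trans _ dA).
    move: sA0; rewrite -(size_map_poly j) E size_mul // -subn1 leq_subLR add1n => sA0.
    by rewrite -(leq_add2r (size A)) (leq_trans sA0) // add1n ltnS.
  by case/orP: (nondeg_lead ndPQ) => [/key-/(_ _ sP0 hP)|/key-/(_ _ sQ0 hQ)].
have [e he] : exists e, h = e%:P by exists h`_0; apply: size1_polyC.
have e0 : e != 0 by rewrite -polyC_eq0 -he.
exists P0, Q0, e^-1; rewrite ?invr_eq0 //; split=> //.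
  by rewrite hP he mul_polyC scalerA mulVf // scale1r.
by rewrite hQ he mul_polyC scalerA mulVf // scale1r.
Qed.

End Constants.

(** * Points, charts and constant points *)

(** For nonzero vectors over a field, [wedge v w = 0] means that they represent the same projective
    point. *)
Definition wedge (R : nzRingType) (v w : R * R) : R := v.1 * w.2 - v.2 * w.1.

Definition mat2 (R : Type) : Type := ((R * R) * (R * R))%type.

Section Mat2.
Variable R : comNzRingType.
Implicit Types (m : mat2 R) (v w : R * R).

Definition act m v : R * R :=
  (m.1.1 * v.1 + m.1.2 * v.2, m.2.1 * v.1 + m.2.2 * v.2).
Definition det2 m : R := m.1.1 * m.2.2 - m.1.2 * m.2.1.
(** The adjugate serves as inverse up to the scalar [det2 m], which is harmless projectively and
    avoids division. *)
Definition adj2 m : mat2 R := ((m.2.2, - m.1.2), (- m.2.1, m.1.1)).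
Definition mul2 m m' : mat2 R :=
  ((m.1.1 * m'.1.1 + m.1.2 * m'.2.1, m.1.1 * m'.1.2 + m.1.2 * m'.2.2),
   (m.2.1 * m'.1.1 + m.2.2 * m'.2.1, m.2.1 * m'.1.2 + m.2.2 * m'.2.2)).
Definition scale2 (u : R) v : R * R := (u * v.1, u * v.2).

Lemma act_mul2 m m' v : act (mul2 m m') v = act m (act m' v).
Proof. by rewrite /act /=; congr pair; ring. Qed.

Lemma act_scale2 m u v : act m (scale2 u v) = scale2 u (act m v).
Proof. by rewrite /act /scale2 /=; congr pair; ring. Qed.

Lemma act_adj2K m v : act m (act (adj2 m) v) = scale2 (det2 m) v.
Proof. by rewrite /act /scale2 /det2 /=; congr pair; ring. Qed.

Lemma adj2_actK m v : act (adj2 m) (act m v) = scale2 (det2 m) v.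
Proof. by rewrite /act /scale2 /det2 /=; congr pair; ring. Qed.

Lemma det2_mul2 m m' : det2 (mul2 m m') = det2 m * det2 m'.
Proof. by rewrite /det2 /mul2 /=; ring. Qed.

Lemma det2_adj2 m : det2 (adj2 m) = det2 m.
Proof. by rewrite /det2 /=; ring. Qed.

Lemma wedge_act m v w : wedge (act m v) (act m w) = det2 m * wedge v w.
Proof. by rewrite /wedge /act /det2 /=; ring. Qed.

Lemma wedgeC v w : wedge v w = - wedge w v.
Proof. by rewrite /wedge; ring. Qed.

Definition lin1 m : {poly R} := m.1.1 *: 'X + m.1.2%:P.
Definition lin2 m : {poly R} := m.2.1 *: 'X + m.2.2%:P.

Lemma size_lin (a b : R) : (size (a *: 'X + b%:P)%R <= 2)%N.
Proof.
rewrite (leq_trans (size_polyD _ _)) // geq_max (leq_trans (size_scale_leq _ _)) ?size_polyX //.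
by rewrite (leq_trans (size_polyC_leq1 _)).
Qed.

Definition fmap d (P Q : {poly R}) v : R * R := (heval d P v.1 v.2, heval d Q v.1 v.2).

Lemma fmap_scale2 d P Q u v : fmap d P Q (scale2 u v) = scale2 (u ^+ d) (fmap d P Q v).
Proof. by rewrite /fmap /scale2 /= !heval_scale. Qed.

Lemma heval1_lin (a b x y : R) : heval 1 (a *: 'X + b%:P) x y = a * x + b * y.
Proof.
rewrite /heval big_ord_recr big_ord1 /= !coefD !coefZ !coefX !coefC /= subnn subn0 !expr1 expr0.
by ring.
Qed.

Lemma hevalX d (g : {poly R}) x y : (size g <= 2)%N ->
  heval d (g ^+ d) x y = heval 1 g x y ^+ d.
Proof.
move=> sg; elim: d => [|d IHd].
  by rewrite /heval big_ord1 coefC /= subnn !expr0 !mulr1.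
rewrite !exprS -[d.+1]add1n hevalM ?IHd // (leq_trans (size_poly_exp_leq _ _)) //.
by rewrite ltnS -[leqRHS]mul1n leq_mul2r -subn1 leq_subLR sg orbT.
Qed.

Lemma heval_comp d (P : {poly R}) m v :
  heval d (heval d (map_poly polyC P) (lin1 m) (lin2 m)) v.1 v.2
  = heval d P (act m v).1 (act m v).2.
Proof.
have hsum (I : finType) (f : I -> {poly R}) :
    heval d (\sum_i f i) v.1 v.2 = \sum_i heval d (f i) v.1 v.2.
  by elim/big_rec2: _ => [|i y1 y2 _ E]; rewrite ?heval0 // hevalD E.
rewrite {1}/heval -/(heval d _ _ _) hsum; apply: eq_bigr => i _.
rewrite coef_map /= -mulrA mul_polyC hevalZ -mulrA; congr (_ * _).
have sX (r : {poly R}) e : (size r <= 2)%N -> (size (r ^+ e) <= e.+1)%N.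
  move=> sr; apply: (leq_trans (size_poly_exp_leq _ _)).
  by rewrite ltnS -[leqRHS]mul1n leq_mul2r -subn1 leq_subLR sr orbT.
have E : heval (i + (d - i)) (lin1 m ^+ i * lin2 m ^+ (d - i)) v.1 v.2 =
    (act m v).1 ^+ i * (act m v).2 ^+ (d - i).
  by rewrite hevalM ?sX ?size_lin // (hevalX i) ?size_lin // (hevalX (d - i)) ?size_lin // !heval1_lin.
by rewrite -E subnKC // -ltnS.
Qed.

End Mat2.

Lemma wedge_colinear (F : fieldType) (v w : F * F) :
  w != (0, 0) -> wedge v w = 0 -> exists u, v = scale2 u w.
Proof.
case: v w => [a b] [c d]; rewrite xpair_eqE negb_and /wedge /scale2 /= => cd.
move=> /eqP; rewrite subr_eq0 => /eqP E; case/orP: cd => [c0|d0].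
  by exists (a / c); congr pair; [rewrite divfK | rewrite mulrAC E mulfK].
by exists (b / d); congr pair; [rewrite mulrAC -E mulfK | rewrite divfK].
Qed.

Lemma scale2_eq0 (F : fieldType) (u : F) v : (scale2 u v == (0, 0)) = (u == 0) || (v == (0, 0)).
Proof. by case: v => a b; rewrite !xpair_eqE /= !mulf_eq0 -orb_andr. Qed.

Lemma act_eq0 (F : fieldType) (m : mat2 F) v :
  det2 m != 0 -> (act m v == (0, 0)) = (v == (0, 0)).
Proof.
move=> m0; apply/eqP/eqP => [E|->]; last by rewrite /act /=; congr pair; ring.
have := adj2_actK m v; rewrite E => /esym E'.
have /eqP : scale2 (det2 m) v = (0, 0) by rewrite E' /act /=; congr pair; ring.
by rewrite scale2_eq0 (negPf m0) => /eqP.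
Qed.

Lemma fmap_neq0 (F : fieldType) d (P Q : {poly F}) v :
  nondeg d P Q -> v != (0, 0) -> fmap d P Q v != (0, 0).
Proof.
move=> nd; apply: contra => /eqP[E1 E2].
by case: v E1 E2 => x y /= E1 E2; have [-> ->] := nd _ _ E1 E2.
Qed.

Lemma poly_ext (L : closedFieldType) (p q : {poly L}) : (forall x, p.[x] = q.[x]) -> p = q.
Proof.
move=> E; apply/eqP; rewrite -subr_eq0; apply/negPn/negP => /closed_nonrootP[x].
by rewrite rootE !hornerE E subrr eqxx.
Qed.

Section Constant.
Variables (k0 : fieldType) (L : closedFieldType) (j : {rmorphism k0 -> L}).
Hypothesis rel_closed : forall (p : {poly k0}) (x : L),
  p != 0 -> root (map_poly j p) x -> exists c, x = j c.
Implicit Types (v w : L * L) (m : mat2 L).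

(** Homogeneous coordinates of a point of the projective line over [k0], infinity included; the zero
    vector also qualifies. *)
Definition cst v := exists u s t, v = (u * j s, u * j t).

Lemma cst_scale2 u v : cst v -> cst (scale2 u v).
Proof. by case=> [c [s [t ->]]]; exists (u * c), s, t; rewrite /scale2 /= !mulrA. Qed.

Lemma cst_unscale2 u v : u != 0 -> cst (scale2 u v) -> cst v.
Proof.
move=> u0 /(cst_scale2 u^-1); rewrite /scale2 /= !mulrA mulVf // !mul1r.
by case: v.
Qed.

Lemma cst_inf x : cst (x, 0).
Proof. by exists x, 1, 0; rewrite rmorph1 rmorph0 mulr1 mulr0. Qed.

Lemma cst_fin a : cst (j a, 1).
Proof. by exists 1, a, 1; rewrite rmorph1 !mul1r. Qed.

Lemma cst_div x y : y != 0 -> cst (x, y) -> exists a, x / y = j a.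
Proof.
move=> y0 [u [s [t [-> E]]]]; move: y0; rewrite E => y0.
exists (s / t); rewrite fmorph_div -mulf_div divff ?mul1r //.
by apply: contraNneq y0 => ->; rewrite mul0r.
Qed.

Lemma div_cst x y a : x = y * j a -> cst (x, y).
Proof. by move=> ->; exists y, a, 1; rewrite rmorph1 mulr1. Qed.

(** The cross-ratio of [v1, v2, v3, v] in homogeneous coordinates, so that infinity is no special
    case. *)
Definition crk v1 v2 v3 v : L * L := (wedge v1 v * wedge v2 v3, wedge v2 v * wedge v1 v3).

(** Up to the product of the scalars of [w1, w2, w3], the map sending [w] to its cross-ratio vector
    is linear, invertible and defined over [k0]. *)
Lemma cst_crk w1 w2 w3 w :
  wedge w1 w2 != 0 -> wedge w1 w3 != 0 -> wedge w2 w3 != 0 ->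
  cst w1 -> cst w2 -> cst w3 -> (cst w <-> cst (crk w1 w2 w3 w)).
Proof.
move=> n12 n13 n23 [u1 [a1 [b1 E1]]] [u2 [a2 [b2 E2]]] [u3 [a3 [b3 E3]]].
move: n12 n13 n23; rewrite {}E1 {}E2 {}E3 /wedge /= => n12 n13 n23.
have wE (u u' : L) a b a' b' : u * j a * (u' * j b') - u * j b * (u' * j a') =
    u * u' * j (a * b' - b * a').
  by rewrite rmorphB !rmorphM /=; ring.
move: n12 n13 n23; rewrite !wE !mulf_eq0 !negb_or !fmorph_eq0.
move=> /andP[/andP[u10 u20] n12] /andP[/andP[_ u30] n13] /andP[_ n23].
split.
  case=> [u [a [b ->]]].
  exists (u1 * u2 * u3 * u), ((a1 * b - b1 * a) * (a2 * b3 - b2 * a3)),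
    ((a2 * b - b2 * a) * (a1 * b3 - b1 * a3)).
  by rewrite /crk /wedge /= !(rmorphB, rmorphM) /=; congr pair; ring.
case: w => x y [u [a [b []]]]; rewrite /wedge /= !wE => E1 E2.
exists (u / (u1 * u2 * u3) / j (a1 * b2 - b1 * a2)),
  (a * a2 / (a2 * b3 - b2 * a3) - b * a1 / (a1 * b3 - b1 * a3)),
  (a * b2 / (a2 * b3 - b2 * a3) - b * b1 / (a1 * b3 - b1 * a3)).
have c12 : j (a1 * b2 - b1 * a2) != 0 by rewrite fmorph_eq0.
have c13 : j (a1 * b3 - b1 * a3) != 0 by rewrite fmorph_eq0.
have c23 : j (a2 * b3 - b2 * a3) != 0 by rewrite fmorph_eq0.
(* Cramer's rule: [w] is recovered from its wedges with [w1] and [w2]. *)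
have Ex : x * j (a1 * b2 - b1 * a2) =
    j a2 * (j a1 * y - j b1 * x) - j a1 * (j a2 * y - j b2 * x).
  by rewrite rmorphB !rmorphM /=; ring.
have Ey : y * j (a1 * b2 - b1 * a2) =
    j b2 * (j a1 * y - j b1 * x) - j b1 * (j a2 * y - j b2 * x).
  by rewrite rmorphB !rmorphM /=; ring.
rewrite [j (_ / _ - _ / _)]rmorphB [j (_ * b2 / _ - _ / _)]rmorphB !fmorph_div.
rewrite [j (a * a2)]rmorphM [j (a * b2)]rmorphM [j (b * a1)]rmorphM [j (b * b1)]rmorphM /=.
move: (j (a1 * b2 - _)) (j (a1 * b3 - _)) (j (a2 * b3 - _)) c12 c13 c23 E1 E2 Ex Ey.
move=> C12 C13 C23 c12 c13 c23 E1 E2 Ex Ey.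
have {}E1 : j a1 * y - j b1 * x = u * j a / (u1 * u2 * u3 * C23).
  have n0 : u1 * (u2 * u3 * C23) != 0 by rewrite !mulf_neq0.
  by apply: (mulfI n0); rewrite -E1; field; rewrite u10 u20 u30 c23.
have {}E2 : j a2 * y - j b2 * x = u * j b / (u1 * u2 * u3 * C13).
  have n0 : u2 * (u1 * u3 * C13) != 0 by rewrite !mulf_neq0.
  by apply: (mulfI n0); rewrite -E2; field; rewrite u10 u20 u30 c13.
rewrite E1 E2 in Ex Ey.
by congr pair; apply: (mulIf c12); [rewrite Ex | rewrite Ey]; field; rewrite u10 u20 u30 c12 c13 c23.
Qed.

End Constant.

(** * The map read in two charts *)

Section Charts.
Variables (k0 : fieldType) (L : closedFieldType) (j : {rmorphism k0 -> L}).
Hypothesis rel_closed : forall (p : {poly k0}) (x : L),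
  p != 0 -> root (map_poly j p) x -> exists c, x = j c.
Variables (n : nat) (P Q : {poly L}).
Hypotheses (sP : (size P <= n.+2)%N) (sQ : (size Q <= n.+2)%N).
Hypothesis PQ_nondeg : nondeg n.+1 P Q.
Hypothesis PQ_sep : wronskian P Q != 0.
Implicit Types (v w : L * L) (m : mat2 L).

Local Notation F := (fmap n.+1 P Q).
Local Notation cst := (cst j).

(* In the charts m (source) and m' (target) the map is given by forms over k0. *)
Definition chartmap m m' := exists (p q : {poly k0}) (u : L),
  [/\ u != 0, (size p <= n.+2)%N, (size q <= n.+2)%N
    & forall v, act m' (F v) =
        scale2 u (fmap n.+1 (map_poly j p) (map_poly j q) (act m v))].

(** Cross-ratios do not change under a chart, so the set of constant points of a chart is determined
    by any three of its points. *)
Lemma chart_crk m v1 v2 v3 v : det2 m != 0 ->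
  wedge v1 v2 != 0 -> wedge v1 v3 != 0 -> wedge v2 v3 != 0 ->
  cst (act m v1) -> cst (act m v2) -> cst (act m v3) ->
  (cst (act m v) <-> cst (crk v1 v2 v3 v)).
Proof.
move=> m0 n12 n13 n23 c1 c2 c3.
rewrite (@cst_crk _ _ _ (act m v1) (act m v2) (act m v3)) ?wedge_act ?mulf_neq0 //.
have -> : crk (act m v1) (act m v2) (act m v3) (act m v) =
    scale2 (det2 m * det2 m) (crk v1 v2 v3 v).
  by rewrite /crk /scale2 /= !wedge_act; congr pair; ring.
split; last exact: cst_scale2.
by apply: cst_unscale2; rewrite mulf_neq0.
Qed.

(** With [cpoly2], this represents over [L] the map from chart [m] to chart [m'], the adjugate
    standing for the inverse of [m]. *)
Definition cpoly1 m m' : {poly L} :=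
  m'.1.1 *: heval n.+1 (map_poly polyC P) (lin1 (adj2 m)) (lin2 (adj2 m))
  + m'.1.2 *: heval n.+1 (map_poly polyC Q) (lin1 (adj2 m)) (lin2 (adj2 m)).
Definition cpoly2 m m' : {poly L} :=
  m'.2.1 *: heval n.+1 (map_poly polyC P) (lin1 (adj2 m)) (lin2 (adj2 m))
  + m'.2.2 *: heval n.+1 (map_poly polyC Q) (lin1 (adj2 m)) (lin2 (adj2 m)).

Lemma size_cpoly1 m m' : (size (cpoly1 m m') <= n.+2)%N.
Proof.
rewrite (leq_trans (size_polyD _ _)) // geq_max.
by rewrite !(leq_trans (size_scale_leq _ _)) // size_heval ?size_lin.
Qed.

Lemma size_cpoly2 m m' : (size (cpoly2 m m') <= n.+2)%N.
Proof.
rewrite (leq_trans (size_polyD _ _)) // geq_max.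
by rewrite !(leq_trans (size_scale_leq _ _)) // size_heval ?size_lin.
Qed.

Lemma fmap_cpoly m m' v :
  fmap n.+1 (cpoly1 m m') (cpoly2 m m') v = act m' (F (act (adj2 m) v)).
Proof. by rewrite /fmap /cpoly1 /cpoly2 !hevalD !hevalZ !heval_comp. Qed.

Lemma cpoly_nondeg m m' : det2 m != 0 -> det2 m' != 0 ->
  nondeg n.+1 (cpoly1 m m') (cpoly2 m m').
Proof.
move=> m0 m0' x y E1 E2.
have : fmap n.+1 (cpoly1 m m') (cpoly2 m m') (x, y) = (0, 0) by rewrite /fmap E1 E2.
rewrite fmap_cpoly => /eqP; rewrite act_eq0 //.
have [[-> ->]//|xy] := eqVneq (x, y) (0, 0).
by rewrite (negPf (fmap_neq0 _ _)) // act_eq0 ?det2_adj2.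
Qed.

Lemma wronskian_cpoly m m' : wronskian (cpoly1 m m') (cpoly2 m m') =
  (det2 m' * det2 m) *: heval (n + n) (map_poly polyC (wronskian P Q))
                          (lin1 (adj2 m)) (lin2 (adj2 m)).
Proof.
have -> : wronskian (cpoly1 m m') (cpoly2 m m') = (det2 m') *:
   wronskian (heval n.+1 (map_poly polyC P) (lin1 (adj2 m)) (lin2 (adj2 m)))
             (heval n.+1 (map_poly polyC Q) (lin1 (adj2 m)) (lin2 (adj2 m))).
  rewrite /wronskian /cpoly1 /cpoly2 !(derivD, derivZ) /det2 -!mul_polyC polyCB !polyCM; ring.
rewrite wronskian_heval // /wronskian.
have -> : (lin1 (adj2 m))^`() * lin2 (adj2 m) - lin1 (adj2 m) * (lin2 (adj2 m))^`() = (det2 m)%:P.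
  rewrite /lin1 /lin2 !(derivD, derivZ, derivC, derivX) /det2 /= -!mul_polyC.
  by rewrite polyCB !polyCM !polyCN; ring.
by rewrite mulrC mul_polyC scalerA.
Qed.

Lemma wronskian_cpoly_neq0 m m' : det2 m != 0 -> det2 m' != 0 ->
  wronskian (cpoly1 m m') (cpoly2 m m') != 0.
Proof.
move=> m0 m0'; rewrite wronskian_cpoly scaler_eq0 negb_or mulf_neq0 //=.
apply: contra PQ_sep => /eqP E; apply/eqP/poly_ext => x.
rewrite horner0 -(@heval_y1 _ (n + n)) ?size_wronskian //.
have := heval_comp (n + n) (wronskian P Q) (adj2 m) (act m (x, 1)).
rewrite E heval0 adj2_actK heval_scale => /esym/eqP.
by rewrite mulf_eq0 expf_eq0 (negPf m0) andbF => /eqP.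
Qed.

Lemma chartmap_of_points m m' (s : seq k0) : det2 m != 0 -> det2 m' != 0 ->
  uniq s -> (n.+1 + n.+1 < size s)%N ->
  (forall a, a \in s -> cst (act m' (F (act (adj2 m) (j a, 1))))) -> chartmap m m'.
Proof.
move=> m0 m0' us ss H; have nd := cpoly_nondeg m0 m0'.
have /boolp.choice[f fP] : forall a, exists bc : k0 * k0, a \in s ->
    bc != (0, 0) /\ j bc.2 * (cpoly1 m m').[j a] = j bc.1 * (cpoly2 m m').[j a].
  move=> a; case: (boolP (a \in s)) => [as_|]; last by exists (0, 0).
  have [u [b [c E]]] := H a as_; exists (b, c) => _ /=.
  have : fmap n.+1 (cpoly1 m m') (cpoly2 m m') (j a, 1) != (0, 0).
    by rewrite fmap_neq0 // xpair_eqE oner_eq0 andbF.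
  rewrite fmap_cpoly E => ne; move: E.
  rewrite -fmap_cpoly /fmap /= !heval_y1 ?size_cpoly1 ?size_cpoly2 // => -[-> ->].
  split; last by ring.
  by apply: contraNneq ne => -[-> ->]; rewrite rmorph0 mulr0.
have [a /fP[]|a /fP[]//|p [q [u u0 [sp sq Ep Eq]]]] :=
  @map_const _ _ j n.+1 (cpoly1 m m') (cpoly2 m m') s (fst \o f) (snd \o f)
   (size_cpoly1 _ _) (size_cpoly2 _ _) nd us ss.
  by move=> + _; rewrite /= -surjective_pairing.
(* The composite of [m] and its adjugate multiplies vectors by [det2 m], hence values of forms by
   its [n.+1]-st power. *)
- exists p, q, (u / det2 m ^+ n.+1); split=> // [|v].
    by rewrite mulf_neq0 ?invr_eq0 ?expf_eq0 //=.
  have := fmap_cpoly m m' (act m v); rewrite adj2_actK fmap_scale2 act_scale2.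
  rewrite Ep Eq /fmap !hevalZ => E.
  have d0 : det2 m ^+ n.+1 != 0 by rewrite expf_eq0.
  case: (act m' _) E => x y; rewrite /scale2 /= => -[E1 E2].
  by congr pair; apply: (mulfI d0); rewrite -?E1 -?E2; field.
Qed.

Lemma chartmap_nondeg m m' p q u : det2 m != 0 -> det2 m' != 0 -> u != 0 ->
  (forall v, act m' (F v) = scale2 u (fmap n.+1 (map_poly j p) (map_poly j q) (act m v))) ->
  nondeg n.+1 (map_poly j p) (map_poly j q).
Proof.
move=> m0 m0' u0 E x y E1 E2.
have f0 : fmap n.+1 (map_poly j p) (map_poly j q) (x, y) = (0, 0) by rewrite /fmap E1 E2.
have := E (act (adj2 m) (x, y)); rewrite act_adj2K fmap_scale2 f0.
rewrite /scale2 /= !mulr0 => /eqP; rewrite act_eq0 // => /eqP F0.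
have : act (adj2 m) (x, y) == (0, 0).
  by apply: contraTT isT => ne; have := fmap_neq0 PQ_nondeg ne; rewrite F0 eqxx.
by rewrite act_eq0 ?det2_adj2 // => /eqP[].
Qed.

Lemma cst_fmap (p q : {poly k0}) v :
  cst v -> cst (fmap n.+1 (map_poly j p) (map_poly j q) v).
Proof.
case=> [u [s [t ->]]]; exists (u ^+ n.+1), (heval n.+1 p s t), (heval n.+1 q s t).
by rewrite /fmap /= !heval_scale !heval_map.
Qed.

(** A finite point with image [(s : t)] is a root of [t p - s q], a nonzero polynomial over [k0]. *)
Lemma fmap_cst (p q : {poly k0}) v : (size p <= n.+2)%N -> (size q <= n.+2)%N ->
  nondeg n.+1 (map_poly j p) (map_poly j q) -> v != (0, 0) ->
  cst (fmap n.+1 (map_poly j p) (map_poly j q) v) -> cst v.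
Proof.
move=> sp sq nd v0 [u [s [t E]]]; have := fmap_neq0 nd v0; rewrite E => ust.
case: v v0 E => x y v0; rewrite /fmap /= => -[E1 E2].
have [->|y0] := eqVneq y 0; first exact: cst_inf.
have smap (r : {poly k0}) : (size r <= n.+2)%N -> (size (map_poly j r) <= n.+2)%N.
  by rewrite size_map_poly.
pose r := t *: p - s *: q.
have sr : (size r <= n.+2)%N.
  rewrite (leq_trans (size_polyD _ _)) // size_polyN geq_max.
  by rewrite !(leq_trans (size_scale_leq _ _)).
have rE z z' : heval n.+1 (map_poly j r) z z' =
   j t * heval n.+1 (map_poly j p) z z' - j s * heval n.+1 (map_poly j q) z z'.
  by rewrite /r rmorphB /= !map_polyZ hevalB !hevalZ.
(* Otherwise one form would be a multiple of the other, and a zero of the latter would be a common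
   zero. *)
have r0 : r != 0.
  apply/eqP => r0.
  have {}rE z z' : j t * heval n.+1 (map_poly j p) z z' = j s * heval n.+1 (map_poly j q) z z'.
    by apply/eqP; rewrite -subr_eq0 -rE r0 rmorph0 heval0.
  have st : (j t != 0) || (j s != 0).
    rewrite -negb_and; apply: contra ust => /andP[/eqP-> /eqP->]; by rewrite !mulr0.
  case/orP: st => [t0|s0].
    have [z [z' [qz zz]]] := form_zero (ltn0Sn n) (smap _ sq).
    have pz : heval n.+1 (map_poly j p) z z' = 0.
      by apply: (mulfI t0); rewrite rE qz !mulr0.
    by have [z0 z'0] := nd _ _ pz qz; rewrite z0 z'0 eqxx in zz.
  have [z [z' [pz zz]]] := form_zero (ltn0Sn n) (smap _ sp).
  have qz : heval n.+1 (map_poly j q) z z' = 0.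
    by apply: (mulfI s0); rewrite -rE pz !mulr0.
  by have [z0 z'0] := nd _ _ pz qz; rewrite z0 z'0 eqxx in zz.
have : heval n.+1 (map_poly j r) x y == 0 by rewrite rE E1 E2 subr_eq0; apply/eqP; ring.
rewrite heval_div ?smap // mulf_eq0 expf_eq0 (negPf y0) andbF /= => /(rel_closed r0)[c Ec].
by apply: (div_cst (a := c)); rewrite -Ec mulrC divfK.
Qed.

(** Forms over [k0] preserve constant points, and [fmap_cst] gives the converse. For consecutive
    charts this is [phi^-1 (X_(i+1)) = X_i]. *)
Lemma chartmap_iff m m' v : det2 m != 0 -> det2 m' != 0 -> chartmap m m' ->
  v != (0, 0) -> (cst (act m' (F v)) <-> cst (act m v)).
Proof.
move=> m0 m0' [p [q [u [u0 sp sq E]]]] v0; rewrite E; split=> [/(cst_unscale2 u0)|c].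
  apply: fmap_cst => //; last by rewrite act_eq0.
  exact: (chartmap_nondeg m0 m0' u0 E).
exact/cst_scale2/cst_fmap.
Qed.

Lemma chartmap_cpoly m m' : det2 m != 0 -> chartmap m m' ->
  exists (p q : {poly k0}) (e : L),
    [/\ e != 0, cpoly1 m m' = e *: map_poly j p & cpoly2 m m' = e *: map_poly j q].
Proof.
move=> m0 [p [q [u [u0 sp sq E]]]]; exists p, q, (u * det2 m ^+ n.+1).
set e := u * det2 m ^+ n.+1.
have e0 : e != 0 by rewrite mulf_neq0 ?expf_eq0.
have Ez z : act m' (F (act (adj2 m) (z, 1))) =
    scale2 e ((map_poly j p).[z], (map_poly j q).[z]).
  rewrite E act_adj2K fmap_scale2 /fmap /= !heval_y1 ?size_map_poly //.
  by rewrite /scale2 /= !mulrA.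
split=> //.
  apply: poly_ext => z.
  have := Ez z; rewrite -fmap_cpoly /fmap /= !heval_y1 ?size_cpoly1 ?size_cpoly2 //.
  by move=> -[-> _]; rewrite hornerZ.
  apply: poly_ext => z.
  have := Ez z; rewrite -fmap_cpoly /fmap /= !heval_y1 ?size_cpoly1 ?size_cpoly2 //.
  by move=> -[_ ->]; rewrite hornerZ.
Qed.

(** In the charts the Wronskian is, up to a scalar, a nonzero polynomial over [k0], so its roots are
    constant. *)
Lemma critical_cst m m' v : det2 m != 0 -> det2 m' != 0 -> chartmap m m' ->
  heval (n + n) (wronskian P Q) v.1 v.2 = 0 -> cst (act m v).
Proof.
move=> m0 m0' mm' wv; have [p [q [e [e0 E1 E2]]]] := chartmap_cpoly m0 mm'.
have [y0|y0] := eqVneq (act m v).2 0.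
  by case: (act m v) y0 => x y /= ->; apply: cst_inf.
have EW : wronskian (cpoly1 m m') (cpoly2 m m') = (e * e) *: map_poly j (wronskian p q).
  rewrite E1 E2 /wronskian !derivZ !deriv_map rmorphB !rmorphM /= -!mul_polyC polyCM.
  move: (map_poly j p) (map_poly j q) (map_poly j p^`()) (map_poly j q^`()) => A B A' B'; ring.
have W0 := wronskian_cpoly_neq0 m0 m0'.
have w0 : wronskian p q != 0.
  by apply: contraNneq W0 => w0; rewrite EW w0 rmorph0 scaler0.
pose z := (act m v).1 / (act m v).2.
have : root (map_poly j (wronskian p q)) z.
  have : (wronskian (cpoly1 m m') (cpoly2 m m')).[z] = 0.
    rewrite wronskian_cpoly hornerZ horner_heval.
    have -> : (lin1 (adj2 m)).[z] = (act (adj2 m) (z, 1)).1.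
      by rewrite /lin1 /act /= !hornerE.
    have -> : (lin2 (adj2 m)).[z] = (act (adj2 m) (z, 1)).2.
      by rewrite /lin2 /act /= !hornerE.
    have -> : (z, 1) = scale2 (act m v).2^-1 (act m v).
      by rewrite /scale2 /= mulVf // mulrC.
    by rewrite act_scale2 adj2_actK /scale2 /= !heval_scale wv !mulr0.
  rewrite EW hornerZ => /eqP; rewrite !mulf_eq0 (negPf e0) /=; exact.
move=> /(rel_closed w0)[c Ec]; case: (act m v) y0 @z Ec => x y /= y0 Ec.
by apply: (div_cst (a := c)); rewrite -Ec mulrC divfK.
Qed.

(** By [chart_crk] the three common points force [m] and [m'] to have the same constant points, so
    the map preserves those of [m]. *)
Lemma chartmap_three_points m m' v1 v2 v3 : det2 m != 0 -> det2 m' != 0 -> chartmap m m' ->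
  wedge v1 v2 != 0 -> wedge v1 v3 != 0 -> wedge v2 v3 != 0 ->
  cst (act m v1) -> cst (act m v2) -> cst (act m v3) ->
  cst (act m' v1) -> cst (act m' v2) -> cst (act m' v3) -> chartmap m m.
Proof.
move=> m0 m0' mm' n12 n13 n23 c1 c2 c3 c1' c2' c3'.
have [s us ss] := constants_uniq rel_closed (n.+1 + n.+1).+1.
apply: (@chartmap_of_points _ _ s) => //; rewrite ?ss // => a _.
set v := act (adj2 m) (j a, 1).
have v0 : v != (0, 0) by rewrite act_eq0 ?det2_adj2 // xpair_eqE oner_eq0 andbF.
apply/(chart_crk (v1 := v1) (v2 := v2) (v3 := v3)) => //.
apply/(chart_crk (m := m')) => //; apply/(chartmap_iff m0 m0' mm' v0).
by rewrite act_adj2K; apply/cst_scale2/cst_fin.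
Qed.

End Charts.

(** * From constant charts to a constant conjugate *)

Section Additive.
Variables (k0 : fieldType) (L : closedFieldType) (j : {rmorphism k0 -> L}).
Hypothesis rel_closed : forall (p : {poly k0}) (x : L),
  p != 0 -> root (map_poly j p) x -> exists c, x = j c.

(** This is [map_const] with denominator 1; the constant coefficient of [1 = u q] shows that the
    scalar [u] lies in [k0]. *)
Lemma poly_const (p : {poly L}) :
  (forall a, exists b, p.[j a] = j b) -> exists r, p = map_poly j r.
Proof.
move=> /boolp.choice[f fP].
have [->|p0] := eqVneq p 0; first by exists 0; rewrite rmorph0.
set d := (size p).-1; have sp : size p = d.+1 by rewrite prednK ?size_poly_gt0.
have [s us ss] := constants_uniq rel_closed (d + d).+1.
have nd : nondeg d p 1.
  apply: coprime_nondeg; last by rewrite coprimep1.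
  by rewrite sp size_poly1; apply/maxn_idPl.
have s1 : (size (1%R : {poly L}) <= d.+1)%N by rewrite size_poly1.
have [||a _|a _|r [q [u u0 [_ _ Er Eq]]]] := @map_const _ _ j d p 1 s f (fun=> 1) _ s1 nd us.
- by rewrite sp.
- by rewrite ss.
- by rewrite xpair_eqE oner_eq0 andbF.
- by rewrite rmorph1 mul1r hornerC mulr1 fP.
have u1 : u = j (q`_0)^-1.
  rewrite fmorphV; have /(congr1 (fun r : {poly L} => r`_0)) := Eq.
  rewrite coefZ coef_map coefC /= => E1.
  have q0 : j q`_0 != 0 by apply: contraTneq (oner_neq0 L) => q0; rewrite E1 q0 mulr0 eqxx.
  by apply: (mulIf q0); rewrite mulVf // -E1.
by exists ((q`_0)^-1 *: r); rewrite map_polyZ -u1.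
Qed.

(** The shape of the set of finite constant points of a chart in which infinity is constant. *)
Definition affine_line (x u y : L) := exists a, y = x + u * j a.

Lemma affine_line_origin x u : affine_line x u x.
Proof. by exists 0; rewrite rmorph0 mulr0 addr0. Qed.

Lemma affine_polynomial (p : {poly L}) x u x' u' : u != 0 -> u' != 0 ->
  (forall y, affine_line x' u' p.[y] <-> affine_line x u y) ->
  exists f : {poly k0}, forall z, p.[x + u * z] = x' + u' * (map_poly j f).[z].
Proof.
move=> u0 u0' H.
pose R := u'^-1 *: (p \Po (u *: 'X + x%:P) - x'%:P).
have RE z : R.[z] = (p.[x + u * z] - x') / u'.
  by rewrite /R !(hornerZ, hornerD, hornerN, hornerC, hornerX, horner_comp) mulrC [_ + x]addrC.
have [|f Ef] := @poly_const R.
  move=> a; have [|b Eb] := (H (x + u * j a)).2; first by exists a.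
  by exists b; rewrite RE Eb addrAC subrr add0r mulrC mulKf.
by exists f => z; rewrite -Ef RE mulrCA mulfV // mulr1 addrCA subrr addr0.
Qed.

(* A root of a Hasse derivative is carried by a change of coordinates to a root
   of the corresponding Hasse derivative, which is defined over k0. *)
Lemma nderivn_root_affine (p : {poly L}) x u x' u' i y : u != 0 -> u' != 0 ->
  (forall y, affine_line x' u' p.[y] <-> affine_line x u y) ->
  (0 < i)%N -> p^`N(i) != 0 -> root p^`N(i) y -> affine_line x u y.
Proof.
move=> u0 u0' /(affine_polynomial u0 u0')[f fE] i0 pi0 piy.
set r := map_poly j f in fE *.
pose N := maxn i.+1 (maxn (size p) (size r)).
have iN : (i < N)%N by rewrite leq_max leqnn.
have spN : (size p <= N)%N by rewrite !leq_max leqnn orbT.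
have srN : (size r <= N)%N by rewrite !leq_max leqnn !orbT.
have key z : p^`N(i).[x + u * z] * u ^+ i = u' * r^`N(i).[z].
  (* Taylor expansions in [h] of both sides of the identity at [z + h]. Comparing coefficients of
     degree [i > 0] removes the translation [x']. *)
  pose S1 := \poly_(k < N) (p^`N(k).[x + u * z] * u ^+ k).
  pose S2 := x'%:P + u' *: \poly_(k < N) r^`N(k).[z].
  have S12 : S1 = S2.
    apply: poly_ext => h; rewrite /S1 /S2 hornerD hornerC hornerZ !horner_poly.
    rewrite -(nderiv_taylor_wide _ srN); last exact: mulrC.
    rewrite -fE mulrDr addrA (nderiv_taylor_wide _ spN); last exact: mulrC.
    by apply: eq_bigr => k _; rewrite exprMn mulrA.
  have := congr1 (fun s : {poly L} => s`_i) S12.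
  rewrite /S1 /S2 coefD coefZ coefC !coef_poly iN /=.
  by case: (i) i0 => // k _; rewrite add0r.
have fi0 : f^`N(i) != 0.
  apply: contraNneq pi0 => fi0; apply/eqP/poly_ext => y'.
  have := key ((y' - x) / u); rewrite /r nderivn_map fi0 rmorph0 !horner0 mulr0.
  rewrite mulrCA mulfV // mulr1 addrCA subrr addr0 => /eqP.
  by rewrite mulf_eq0 expf_eq0 (negPf u0) andbF orbF => /eqP.
have : root (map_poly j f^`N(i)) ((y - x) / u).
  have := key ((y - x) / u); rewrite mulrCA mulfV // mulr1 addrCA subrr addr0.
  rewrite (rootP piy) mul0r /r nderivn_map => /esym/eqP.
  by rewrite mulf_eq0 (negPf u0').
move=> /(rel_closed fi0)[c Ec]; exists c.
by rewrite -Ec mulrCA mulfV // mulr1 addrCA subrr addr0.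
Qed.

Lemma affine_chain_conjugate (p : {poly L}) x0 u0 x1 u1 x2 u2 x3 u3 :
  u0 != 0 -> u1 != 0 -> u2 != 0 -> u3 != 0 -> (2 < size p)%N -> p^`() != 0 ->
  (forall y, affine_line x1 u1 p.[y] <-> affine_line x0 u0 y) ->
  (forall y, affine_line x2 u2 p.[y] <-> affine_line x1 u1 y) ->
  (forall y, affine_line x3 u3 p.[y] <-> affine_line x2 u2 y) ->
  (forall y, ~ [/\ affine_line x0 u0 y, affine_line x1 u1 y & affine_line x2 u2 y]) ->
  exists (x w : L) (r : {poly k0}), w != 0 /\
    forall z, p.[x + w * z] = x + w * (map_poly j r).[z].
Proof.
move=> n0 n1 n2 n3 sp p'0 A0 A1 A2 nocommon.
(* A nonconstant Hasse derivative has a root, which would lie on all three lines. *)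
have hasse i y : (0 < i)%N -> p^`N(i).[y] = p^`N(i).[0].
  move=> i0; have [->|pi0] := eqVneq p^`N(i) 0; first by rewrite !horner0.
  have /eqP s1 : size p^`N(i) == 1%N.
    apply/negPn/negP => /closed_rootP[z rz]; apply: (nocommon z); split.
    - exact: (nderivn_root_affine n0 n1 A0 i0).
    - exact: (nderivn_root_affine n1 n2 A1 i0).
    - exact: (nderivn_root_affine n2 n3 A2 i0).
  by rewrite (size1_polyC (eq_leq s1)) !hornerC.
(* The Taylor coefficients of positive order at [y] do not depend on [y], so [p - p(0)] is
   additive. *)
have add y h : p.[y + h] = p.[y] + p.[h] - p.[0].
  rewrite -{2}[h]add0r !nderiv_taylor; try exact: mulrC.
  case: (size p) sp => // N _; rewrite !big_ord_recl /= !nderivn0 !expr0 !mulr1.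
  rewrite -addrA; congr (_ + _); rewrite addrAC subrr add0r.
  by apply: eq_bigr => i _; rewrite hasse.
have p'1 : p^`().[0] != 0.
  apply: contraNneq p'0 => E; apply/eqP/poly_ext => y.
  by rewrite -nderivn1 hasse // nderivn1 E horner0.
(* Since [p'(0)] is nonzero, X divides [p - p(0)] only once; the quotient is not constant because
   [p] has degree at least 2, and its root [w] is nonzero. *)
have [w w0 pw] : exists2 w, w != 0 & p.[w] = p.[0].
  have /factor_theorem[s Es] : root (p - p.[0]%:P) 0 by rewrite rootE !hornerE subrr.
  move: Es; rewrite subr0 => Es.
  have s0 : s.[0] != 0.
    have := congr1 (fun q : {poly L} => q^`().[0]) Es.
    rewrite derivB derivC subr0 derivM derivX !hornerE => E.
    by rewrite E in p'1.
  have ss : (1 < size s)%N.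
    have sn0 : s != 0 by apply: contraNneq s0 => ->; rewrite horner0.
    have : size (p - p.[0]%:P) = size p.
      by rewrite size_polyDl // size_polyN (leq_ltn_trans (size_polyC_leq1 _)) // ltnW.
    by rewrite Es size_mulX // => E; rewrite -ltnS E.
  have [w rw] := closed_root ss; exists w.
    by apply: contraNneq s0 => w0; rewrite w0 in rw.
  have := congr1 (fun q : {poly L} => q.[w]) Es.
  by rewrite !hornerE (rootP rw) mul0r => /eqP; rewrite subr_eq0 => /eqP.
have per y : p.[y + w] = p.[y] by rewrite add pw addrK.
(* Translation by the period [w] preserves each line, so [w] is a constant multiple of its
   direction. *)
have wline x u x' u' : (forall y, affine_line x' u' p.[y] <-> affine_line x u y) ->
    exists a, w = u * j a.
  move=> A; have : affine_line x u (x + w).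
    by apply/A; rewrite per; apply/A/affine_line_origin.
  by case=> a /addrI->; exists a.
have [a0 wa0] := wline _ _ _ _ A0; have [a1 wa1] := wline _ _ _ _ A1.
have a10 : j a1 != 0 by apply: contraNneq w0 => E; rewrite wa1 E mulr0.
pose R := w^-1 *: (p \Po (w *: 'X) - p.[0]%:P).
have RE z : R.[z] = (p.[w * z] - p.[0]) / w.
  by rewrite /R !(hornerZ, hornerD, hornerN, hornerC, hornerX, horner_comp) mulrC.
(* Differences of values of [p] on the line through [x0] lie in [u1 k0 = w k0], so [R] maps
   constants to constants. *)
have [|r Er] := @poly_const R.
  move=> a; rewrite RE.
  have [|b Eb] := (A0 (x0 + w * j a)).2.
    by exists (a0 * a); rewrite wa0 rmorphM mulrA.
  have [c Ec] := (A0 x0).2 (affine_line_origin _ _).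
  exists ((b - c) / a1); rewrite fmorph_div rmorphB.
  have -> : p.[w * j a] - p.[0] = p.[x0 + w * j a] - p.[x0] by rewrite add; ring.
  rewrite Eb Ec.
  by rewrite wa1; field; rewrite a10 n1.
(* Centring the coordinate at a fixed point absorbs the constant term [p(0)]. *)
have [x rx] : exists x, root (p - 'X) x.
  by apply: closed_root; rewrite size_polyDl ?size_polyN ?size_polyX // (leq_trans _ sp).
have px : p.[x] = x by apply/eqP; rewrite -subr_eq0; move: rx; rewrite rootE !hornerE.
exists x, w, r; split=> // z.
by rewrite add px -Er RE mulrCA mulfV // mulr1 addrA.
Qed.

End Additive.

(** * Exceptional points and the constant conjugate *)

Section Conjugate.
Variables (k0 : fieldType) (L : closedFieldType) (j : {rmorphism k0 -> L}).
Hypothesis rel_closed : forall (p : {poly k0}) (x : L),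
  p != 0 -> root (map_poly j p) x -> exists c, x = j c.
Variables (n : nat) (P Q : {poly L}).
Hypotheses (n_gt0 : (0 < n)%N) (sP : (size P <= n.+2)%N) (sQ : (size Q <= n.+2)%N).
Hypothesis PQ_nondeg : nondeg n.+1 P Q.
Hypothesis PQ_sep : wronskian P Q != 0.
Implicit Types (v w : L * L) (m : mat2 L).

Local Notation F := (fmap n.+1 P Q).
Local Notation cst := (cst j).
Local Notation chartmap := (chartmap j n P Q).

(** Infinity and two finite constant points [y a], [y b] serve as reference in [chart_crk]; the
    cross-ratio with [x] is then [(y a - y b) / (y a - x)]. *)
Lemma chart_affine m : det2 m != 0 -> cst (act m (1, 0)) ->
  exists x u, u != 0 /\ forall y, cst (act m (y, 1)) <-> affine_line j x u y.
Proof.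
move=> m0 cinf.
(* At most one constant parameter corresponds to the point at infinity; it is excluded. *)
have [s Hs] : exists s : seq k0, forall a, a \notin s -> m.1.1 - m.2.1 * j a != 0.
  have [[a0 Ea0]|H] := boolp.EM (exists a, m.1.1 - m.2.1 * j a = 0); last first.
    by exists [::] => a _; apply/eqP => E; apply: H; exists a.
  exists [:: a0] => a; rewrite inE; apply: contra => /eqP E.
  have m21 : m.2.1 != 0.
    apply: contraNneq m0 => m21; move: Ea0; rewrite m21 mul0r subr0 => m11.
    by rewrite /det2 m21 m11; apply/eqP; ring.
  rewrite -(inj_eq (fmorph_inj j)) -(inj_eq (mulfI m21)); apply/eqP.
  by apply: (subrI m.1.1); rewrite E Ea0.
have [a as_] := constants_infinite rel_closed s.
have [b] := constants_infinite rel_closed (a :: s); rewrite inE negb_or => /andP[ab bs].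
pose y c := (act (adj2 m) (j c, 1)).1 / (act (adj2 m) (j c, 1)).2.
have yE c : c \notin s -> (y c, 1) = scale2 (act (adj2 m) (j c, 1)).2^-1 (act (adj2 m) (j c, 1)).
  move=> /Hs; rewrite /y /scale2 /= => ne; rewrite mulVf; last first.
    by rewrite mulNr mulr1 addrC.
  by rewrite mulrC.
have ynz c : c \notin s -> (act (adj2 m) (j c, 1)).2^-1 != 0.
  by move=> /Hs ne; rewrite invr_eq0 /= mulNr mulr1 addrC.
have yc c : c \notin s -> cst (act m (y c, 1)).
  by move=> cs; rewrite yE // act_scale2 act_adj2K; do 2![apply: cst_scale2]; apply: cst_fin.
have yab : y a != y b.
  apply/eqP => E; have : wedge (y a, 1) (y b, 1) = 0 by rewrite E /wedge /= mulrC subrr.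
  rewrite !yE //; set ua := _^-1; set ub := _^-1.
  have -> : wedge (scale2 ua (act (adj2 m) (j a, 1))) (scale2 ub (act (adj2 m) (j b, 1))) =
      ua * ub * wedge (act (adj2 m) (j a, 1)) (act (adj2 m) (j b, 1)).
    by rewrite /wedge /scale2 /=; ring.
  rewrite wedge_act det2_adj2 /wedge /= mulr1 mul1r => /eqP.
  by rewrite !mulf_eq0 (negPf m0) (negPf (ynz a as_)) (negPf (ynz b bs)) /= subr_eq0
     (inj_eq (fmorph_inj j)) eq_sym (negPf ab).
exists (y a), (y b - y a); split; first by rewrite subr_eq0 eq_sym.
move=> x; rewrite (@chart_crk _ _ _ m (1, 0) (y a, 1) (y b, 1)) //; first last.
- exact: yc.
- exact: yc.
- by rewrite /wedge /= mulr1 mul1r subr_eq0.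
- by rewrite /wedge /= mulr1 mul0r subr0 oner_eq0.
- by rewrite /wedge /= mulr1 mul0r subr0 oner_eq0.
rewrite /crk /wedge /= !mulr1 !mul0r !mul1r !subr0 !mul1r mulr1.
have ba0 : y b - y a != 0 by rewrite subr_eq0 eq_sym.
split.
  have [->|xa] := eqVneq x (y a); first by move=> _; apply: affine_line_origin.
  move=> /(@cst_div _ _ j); rewrite subr_eq0 eq_sym => /(_ xa)[c Ec]; exists c^-1.
  rewrite fmorphV -Ec; field.
  by rewrite !subr_eq0 eq_sym xa yab.
case=> c ->; rewrite opprD addrA subrr add0r.
exists (y a - y b), 1, c; rewrite rmorph1 mulr1; congr pair; ring.
Qed.

Lemma monomial_of_roots d (G : {poly L}) : (size G <= d.+1)%N ->
  (forall x, x != 0 -> G.[x] != 0) ->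
  exists (e : L) (i : nat), [/\ e != 0, (i <= d)%N & G = e *: 'X^i].
Proof.
move=> sG H; have G0 : G != 0.
  by apply/eqP => G0; have := H 1 (oner_neq0 _); rewrite G0 horner0 eqxx.
have [r Er] := closed_field_poly_normal G.
have r0 : {in r, forall z, z = 0}.
  move=> z zr; apply/eqP/contraT => /H; rewrite Er hornerZ mulf_eq0 negb_or.
  by have := zr; rewrite -root_prod_XsubC => /rootP->; rewrite eqxx andbF.
have rE : \prod_(z <- r) ('X - z%:P) = 'X^(size r) :> {poly L}.
  rewrite (eq_big_seq (fun=> 'X)); first by rewrite big_const_seq count_predT iter_mulr_1.
  by move=> z /r0->; rewrite subr0.
exists (lead_coef G), (size r); split; rewrite ?lead_coef_eq0 -?rE //.
by rewrite -ltnS (leq_trans _ sG) // Er rE size_scale ?lead_coef_eq0 // size_polyXn.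
Qed.

Lemma exists_root d (c : L) : (0 < d)%N -> exists u, u ^+ d = c.
Proof.
move=> d0; have [u] : exists u, root ('X^d - c%:P) u.
  by apply: closed_root; rewrite size_XnsubC.
by rewrite rootE !hornerE subr_eq0 => /eqP; exists u.
Qed.

(** With [b] at 0 and [c] at infinity, both forms vanish only at 0 and infinity. The map is
    therefore a monomial of exponent [d] or [- d], and rescaling the coordinate makes its
    coefficient 1. *)
Lemma two_exceptional_points b c : wedge b c != 0 ->
  (forall v, v != (0, 0) -> wedge c (F v) = 0 -> wedge c v = 0 \/ wedge b v = 0) ->
  (forall v, v != (0, 0) -> wedge b (F v) = 0 -> wedge c v = 0 \/ wedge b v = 0) ->
  exists2 m, det2 m != 0 & chartmap m m.
Proof.
move=> bc Hc Hb.
pose m : mat2 L := ((- b.2, b.1), (- c.2, c.1)).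
have mE v : act m v = (wedge b v, wedge c v) by rewrite /act /wedge /=; congr pair; ring.
have m0 : det2 m != 0.
  by apply: contraNneq bc; rewrite /det2 /wedge /= => E; apply/eqP; rewrite -[RHS]E; ring.
have nz x : x != 0 -> let v := act (adj2 m) (x, 1) in
    [/\ v != (0, 0), wedge b v != 0 & wedge c v != 0].
  move=> x0 v; have := act_adj2K m (x, 1); rewrite -/v mE => -[Eb Ec].
  rewrite Eb Ec !mulr1 mulf_neq0 //; split=> //.
  by rewrite act_eq0 ?det2_adj2 // xpair_eqE oner_eq0 andbF.
have GE x : act m (F (act (adj2 m) (x, 1))) = ((cpoly1 n P Q m m).[x], (cpoly2 n P Q m m).[x]).
  by rewrite -fmap_cpoly /fmap /= !heval_y1 ?size_cpoly1 ?size_cpoly2.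
have G1 x : x != 0 -> (cpoly1 n P Q m m).[x] != 0.
  move=> x0; have [v0 bv cv] := nz x x0; apply/eqP => E.
  have [E1 _] := GE x; have : wedge b (F (act (adj2 m) (x, 1))) = 0.
    by rewrite -E -E1 /act /wedge /=; ring.
  by case/(Hb _ v0) => /eqP; rewrite ?(negPf bv) ?(negPf cv).
have G2 x : x != 0 -> (cpoly2 n P Q m m).[x] != 0.
  move=> x0; have [v0 bv cv] := nz x x0; apply/eqP => E.
  have [_ E1] := GE x; have : wedge c (F (act (adj2 m) (x, 1))) = 0.
    by rewrite -E -E1 /act /wedge /=; ring.
  by case/(Hc _ v0) => /eqP; rewrite ?(negPf bv) ?(negPf cv).
have [e1 [i1 [e10 i1n G1E]]] := monomial_of_roots (size_cpoly1 n P Q m m) G1.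
have [e2 [i2 [e20 i2n G2E]]] := monomial_of_roots (size_cpoly2 n P Q m m) G2.
have nd := cpoly_nondeg PQ_nondeg m0 m0.
(* Having no common zero at infinity makes one exponent [n.+1], and having none at 0 makes one
   exponent 0. *)
have il : (i1 == n.+1) || (i2 == n.+1).
  apply: contraT; rewrite negb_or ![_ == n.+1]eq_sym => /andP[i1n' i2n'].
  by have := nondeg_lead nd; rewrite G1E G2E !coefZ !coefXn (negPf i1n') (negPf i2n') !mulr0 eqxx.
have i0 : (i1 == 0)%N || (i2 == 0)%N.
  apply: contraT; rewrite negb_or => /andP[i10 i20].
  have := nd 0 1; rewrite !heval_y1 ?size_cpoly1 ?size_cpoly2 // G1E G2E.
  rewrite !hornerZ !hornerXn !expr0n (negPf i10) (negPf i20) !mulr0 => /(_ erefl erefl)[_ /eqP].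
  by rewrite oner_eq0.
have hX (x y : L) : heval n.+1 ('X ^+ n.+1) x y = x ^+ n.+1.
  by rewrite hevalX ?size_polyX // -['X]mulr1 heval_XM -polyC1 heval_C expr0 !mulr1.
have h1 (x y : L) : heval n.+1 ('X ^+ 0) x y = y ^+ n.+1 by rewrite expr0 -polyC1 heval_C mul1r.
(* The coordinate is multiplied by [u]; the vector in the hypothesis is the image of the point [j a]
   in the new coordinate. *)
have dil u : u != 0 -> (forall a, cst (u * heval n.+1 (e1 *: 'X^i1) (j a) u,
                              heval n.+1 (e2 *: 'X^i2) (j a) u)) ->
    exists2 m, det2 m != 0 & chartmap m m.
  move=> u0 H; pose m' : mat2 L := ((u * m.1.1, u * m.1.2), m.2).
  have m0' : det2 m' != 0.
    have -> : det2 m' = u * det2 m by rewrite /det2 /=; ring.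
    by rewrite mulf_neq0.
  exists m' => //; have [s us ss] := constants_uniq rel_closed (n.+1 + n.+1).+1.
  apply: (chartmap_of_points PQ_nondeg m0' m0' us) => [|a _]; first by rewrite ss.
  have -> : act (adj2 m') (j a, 1) = act (adj2 m) (j a, u).
    by rewrite /act /=; congr pair; ring.
  have := H a; rewrite -G1E -G2E.
  have := fmap_cpoly n P Q m m (j a, u); rewrite /fmap /= => -[-> ->].
  by congr cst; rewrite [RHS]/act [in RHS]/m' /=; congr pair; ring.
have : (i1 == n.+1) && (i2 == 0)%N || (i1 == 0)%N && (i2 == n.+1).
  by case/orP: il => /eqP E; case/orP: i0 => /eqP E'; move: E; rewrite E' // => ->; rewrite !eqxx ?orbT.
case/orP=> /andP[/eqP i1E /eqP i2E]; subst i1 i2.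
  (* For [(e1 / e2) z^d] the condition on the scale is [u^(d - 1) = e1 / e2], with [d - 1 = n]
     positive. *)
  have [u Eu] := exists_root (e1 / e2) n_gt0.
  have u0 : u != 0.
    apply: contra_eq_neq Eu => ->; rewrite expr0n eqn0Ngt n_gt0 eq_sym.
    by rewrite mulf_neq0 ?invr_eq0.
  apply: (dil u u0) => a; rewrite !hevalZ hX h1.
  exists (e2 * u ^+ n.+1), (a ^+ n.+1), 1; rewrite rmorph1 mulr1 rmorphXn.
  by congr pair; rewrite [u ^+ n.+1]exprS Eu; field.
(* For [(e1 / e2) z^-d] the condition is [u^(d + 1) = e2 / e1]. *)
have [u Eu] := @exists_root n.+2 (e2 / e1) isT.
have u0 : u != 0.
  by apply: contra_eq_neq Eu => ->; rewrite expr0n eq_sym mulf_neq0 ?invr_eq0.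
apply: (dil u u0) => a; rewrite !hevalZ hX h1.
exists e2, 1, (a ^+ n.+1); rewrite rmorph1 mulr1 rmorphXn.
by congr pair; rewrite mulrCA -exprS Eu; field.
Qed.

(** With [c] at infinity the map becomes a polynomial, and the finite constant points of the four
    charts become affine lines to which [affine_chain_conjugate] applies. *)
Lemma one_exceptional_point c m0 m1 m2 m3 : c != (0, 0) ->
  det2 m0 != 0 -> det2 m1 != 0 -> det2 m2 != 0 -> det2 m3 != 0 ->
  chartmap m0 m1 -> chartmap m1 m2 -> chartmap m2 m3 ->
  cst (act m0 c) -> cst (act m1 c) -> cst (act m2 c) -> cst (act m3 c) ->
  (forall v, v != (0, 0) -> cst (act m0 v) -> cst (act m1 v) -> cst (act m2 v) -> wedge c v = 0) ->
  (forall v, v != (0, 0) -> wedge c (F v) = 0 -> wedge c v = 0) ->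
  exists2 m, det2 m != 0 & chartmap m m.
Proof.
move=> c0 d0 d1 d2 d3 f0 f1 f2 cc0 cc1 cc2 cc3 Huniq Hexc.
have [e ce] : exists e, wedge c e != 0.
  case: c c0 {cc0 cc1 cc2 cc3 Huniq Hexc} => x y; rewrite xpair_eqE negb_and /wedge /=.
  case/orP=> [x0|y0]; first by exists (0, 1); rewrite mulr1 mulr0 subr0.
  by exists (1, 0); rewrite mulr1 mulr0 sub0r oppr_eq0.
pose N : mat2 L := ((c.1, e.1), (c.2, e.2)); pose M := adj2 N.
have N0 : det2 N != 0.
  by apply: contraNneq ce; rewrite /det2 /wedge /= => E; apply/eqP; rewrite -[RHS]E; ring.
have M0 : det2 M != 0 by rewrite det2_adj2.
have Ninf : act N (1, 0) = c by rewrite /act /= !mulr1 !mulr0 !addr0; case: (c).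
have NM v : act (adj2 M) v = act N v by rewrite /act /=; congr pair; ring.
pose p' := cpoly1 n P Q M M; pose q' := cpoly2 n P Q M M.
have nd : nondeg n.+1 p' q' := cpoly_nondeg PQ_nondeg M0 M0.
have sp' : (size p' <= n.+2)%N := size_cpoly1 n P Q M M.
have sq' : (size q' <= n.+2)%N := size_cpoly2 n P Q M M.
have GE x : act M (F (act N (x, 1))) = (p'.[x], q'.[x]).
  by rewrite -NM -fmap_cpoly /fmap /= !heval_y1.
have wN v w : wedge (act N v) w = wedge v (act M w).
  by rewrite /wedge /act /=; ring.
(* A root of the denominator would be a point other than [c] sent to [c]. *)
have q'nr x : q'.[x] != 0.
  apply/eqP => E; have v0 : act N (x, 1) != (0, 0).
    by rewrite act_eq0 // xpair_eqE oner_eq0 andbF.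
  have : wedge c (act N (x, 1)) = 0.
    by apply: Hexc => //; rewrite -Ninf wN GE E /wedge /=; ring.
  rewrite -{1}Ninf wedge_act /wedge /= mulr1 mul0r subr0 mulr1 => /eqP.
  by rewrite (negPf N0).
have sq1 : size q' = 1%N.
  by apply/eqP/negPn/negP => /closed_rootP[x /rootP E]; have := q'nr x; rewrite E eqxx.
have [q q0 q'E] : exists2 q, q != 0 & q' = q%:P.
  exists q'`_0; last by apply: size1_polyC; rewrite sq1.
  by have := q'nr 0; rewrite horner_coef0.
have p'n : p'`_n.+1 != 0.
  by have := nondeg_lead nd; rewrite q'E coefC /= eqxx orbF.
pose p := q^-1 *: p'.
have sp : (2 < size p)%N.
  rewrite size_scale ?invr_eq0 //; apply: (leq_trans (_ : 2 < n.+2)%N); first by rewrite !ltnS.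
  by rewrite ltnNge; apply: contra p'n => /leq_sizeP->.
have p'' : p^`() != 0.
  have := wronskian_cpoly_neq0 sP sQ PQ_sep M0 M0; rewrite -/p' -/q' q'E /wronskian derivC mulr0 subr0.
  rewrite mulf_eq0 negb_or => /andP[H _].
  by rewrite derivZ scaler_eq0 invr_eq0 (negPf q0).
have FE x : F (act N (x, 1)) = scale2 (q / det2 N) (act N (p.[x], 1)).
  have := congr1 (act N) (GE x); rewrite act_adj2K q'E hornerC => E.
  have -> : (p.[x], 1) = scale2 q^-1 (p'.[x], q).
    by rewrite /scale2 /= mulVf // hornerZ.
  rewrite act_scale2 -E; move: (F _) (det2 N) N0 => [y1 y2] D D0.
  by rewrite /scale2 /=; congr pair; field; rewrite q0 D0.
have aff m : det2 m != 0 -> cst (act m c) ->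
    exists x u, u != 0 /\ forall y, cst (act m (act N (y, 1))) <-> affine_line j x u y.
  move=> dm cm; have [||x [u [u0 H]]] := @chart_affine (mul2 m N).
  - by rewrite det2_mul2 mulf_neq0.
  - by rewrite act_mul2 Ninf.
  - by exists x, u; split=> // y; rewrite -H act_mul2.
have [x0 [u0 [u0n A0]]] := aff _ d0 cc0.
have [x1 [u1 [u1n A1]]] := aff _ d1 cc1.
have [x2 [u2 [u2n A2]]] := aff _ d2 cc2.
have [x3 [u3 [u3n A3]]] := aff _ d3 cc3.
have vn y : act N (y, 1) != (0, 0) by rewrite act_eq0 // xpair_eqE oner_eq0 andbF.
have step m m' y : det2 m != 0 -> det2 m' != 0 -> chartmap m m' ->
    cst (act m' (act N (p.[y], 1))) <-> cst (act m (act N (y, 1))).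
  move=> dm dm' mm'; rewrite -(chartmap_iff rel_closed PQ_nondeg dm dm' mm' (vn y)) FE act_scale2.
  split; first exact: cst_scale2.
  by apply: cst_unscale2; rewrite mulf_neq0 ?invr_eq0.
have [y|y|y|y [B0 B1 B2]|x [w [r [w0 Er]]]] :=
  @affine_chain_conjugate _ _ j rel_closed p x0 u0 x1 u1 x2 u2 x3 u3 u0n u1n u2n u3n sp p''.
- by rewrite -A1 -A0; apply: step.
- by rewrite -A2 -A1; apply: step.
- by rewrite -A3 -A2; apply: step.
- have := Huniq _ (vn y) ((A0 y).2 B0) ((A1 y).2 B1) ((A2 y).2 B2).
  rewrite -{1}Ninf wedge_act /wedge /= mulr1 mul0r subr0 mulr1 => /eqP.
  by rewrite (negPf N0).
(* The coordinate [(y - x) / w], in which the polynomial is [r]. *)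
pose S : mat2 L := ((1, - x), (0, w)).
have S0 : det2 S != 0 by rewrite /det2 /= mul1r mulr0 subr0.
exists (mul2 S M); first by rewrite det2_mul2 mulf_neq0.
have [s us ss] := constants_uniq rel_closed (n.+1 + n.+1).+1.
have SM0 : det2 (mul2 S M) != 0 by rewrite det2_mul2 mulf_neq0.
apply: (chartmap_of_points PQ_nondeg SM0 SM0 us) => [|a _]; first by rewrite ss.
have -> : act (adj2 (mul2 S M)) (j a, 1) = act N (x + w * j a, 1).
  by rewrite /act /=; congr pair; ring.
rewrite FE act_scale2 act_mul2 adj2_actK; apply: cst_scale2; rewrite act_scale2; apply: cst_scale2.
rewrite Er horner_map /act /=; exists w, r.[a], 1.
by rewrite rmorph1; congr pair; ring.
Qed.

(** A critical point [c] is constant in every chart that has a successor. The fifth chart thus puts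
    [c] in [X_3], which is needed for its preimages to lie in [X_2]. *)
Lemma constant_conjugate m0 m1 m2 m3 m4 :
  det2 m0 != 0 -> det2 m1 != 0 -> det2 m2 != 0 -> det2 m3 != 0 -> det2 m4 != 0 ->
  chartmap m0 m1 -> chartmap m1 m2 -> chartmap m2 m3 -> chartmap m3 m4 ->
  exists2 m, det2 m != 0 & chartmap m m.
Proof.
move=> d0 d1 d2 d3 d4 f0 f1 f2 f3.
have [//|nogoal] := boolp.EM (exists2 m, det2 m != 0 & chartmap m m).
have three v1 v2 v3 : wedge v1 v2 != 0 -> wedge v1 v3 != 0 -> wedge v2 v3 != 0 ->
    cst (act m0 v1) -> cst (act m0 v2) -> cst (act m0 v3) ->
    cst (act m1 v1) -> cst (act m1 v2) -> cst (act m1 v3) -> False.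
  move=> w12 w13 w23 *; apply: nogoal; exists m0 => //.
  exact: (chartmap_three_points rel_closed PQ_nondeg d0 d1 f0 w12 w13 w23).
have [c1 [c2 [wc cn]]] : exists x y, heval (n + n) (wronskian P Q) x y = 0 /\ (x, y) != (0, 0).
  by apply: form_zero; rewrite ?addn_gt0 ?n_gt0 ?size_wronskian.
pose c := (c1, c2); have crit m m' : det2 m != 0 -> det2 m' != 0 -> chartmap m m' -> cst (act m c).
  by move=> dm dm' mm'; apply: (critical_cst rel_closed sP sQ PQ_sep dm dm' mm').
have X0c := crit _ _ d0 d1 f0; have X1c := crit _ _ d1 d2 f1.
have X2c := crit _ _ d2 d3 f2; have X3c := crit _ _ d3 d4 f3.
have pull m m' b v : det2 m != 0 -> det2 m' != 0 -> chartmap m m' -> cst (act m' b) ->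
    b != (0, 0) -> v != (0, 0) -> wedge b (F v) = 0 -> cst (act m v).
  move=> dm dm' mm' cb b0 v0; rewrite wedgeC => /eqP; rewrite oppr_eq0 => /eqP.
  move=> /(wedge_colinear b0)[u E]; apply/(chartmap_iff rel_closed PQ_nondeg dm dm' mm' v0).
  by rewrite E act_scale2; apply: cst_scale2.
(* If a second point [b] lies in [X_0], [X_1] and [X_2], then [X_0] and [X_1] share only [b] and
   [c]. The preimages of both lie in [X_0] and [X_1], because [b] and [c] lie in [X_1] and [X_2]. *)
have [[b [bc X0b X1b X2b]]|H] := boolp.EM
    (exists b, [/\ wedge b c != 0, cst (act m0 b), cst (act m1 b) & cst (act m2 b)]).
  have b0 : b != (0, 0).
    by apply: contraNneq bc => ->; rewrite /wedge /= !mul0r subrr.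
  have alt v : v != (0, 0) -> cst (act m0 v) -> cst (act m1 v) -> wedge c v = 0 \/ wedge b v = 0.
    move=> v0 X0v X1v.
    have [|cv] := eqVneq (wedge c v) 0; first by left.
    have [|bv] := eqVneq (wedge b v) 0; first by right.
    by case: (three b c v bc bv cv).
  apply: (two_exceptional_points bc) => v v0 E; apply: alt => //.
  - exact: (pull _ _ _ _ d0 d1 f0 X1c).
  - exact: (pull _ _ _ _ d1 d2 f1 X2c).
  - exact: (pull _ _ _ _ d0 d1 f0 X1b).
  - exact: (pull _ _ _ _ d1 d2 f1 X2b).
(* Otherwise [c] alone is common to [X_0, X_1, X_2]. As it lies in [X_1, X_2, X_3], its preimages
   are common to [X_0, X_1, X_2] and equal [c]. *)
have Huniq v : v != (0, 0) -> cst (act m0 v) -> cst (act m1 v) -> cst (act m2 v) -> wedge c v = 0.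
  move=> v0 A0 A1 A2; apply/eqP/contraT => cv; case: H; exists v.
  by rewrite wedgeC oppr_eq0.
apply: (one_exceptional_point cn d0 d1 d2 d3 f0 f1 f2 X0c X1c X2c X3c Huniq) => v v0 E.
apply: Huniq => //.
- exact: (pull _ _ _ _ d0 d1 f0 X1c).
- exact: (pull _ _ _ _ d1 d2 f1 X2c).
- exact: (pull _ _ _ _ d2 d3 f2 X3c).
Qed.

End Conjugate.

(** * Rational functions and pairs of forms *)

Lemma eq_div_common (E : fieldType) (x y a b c e : E) : c != 0 -> e != 0 ->
  x * e = c * a -> y * e = c * b -> x / y = a / b.
Proof.
move=> c0 e0 Ex Ey; rewrite -[x](mulfK e0) -[y](mulfK e0) Ex Ey.
by rewrite invf_div mulrA divfK // -mulf_div divff // mul1r.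
Qed.

Lemma mul_div_cancel (E : fieldType) (a x y z : E) : y != 0 ->
  a * (x / y) * (y * z) = a * x * z.
Proof. by move=> y0; rewrite -!mulrA mulKf. Qed.

Section RationalFunctions.
Variable F : fieldType.
Implicit Types (f : ratfun F) (p q r s : {poly F}).

Lemma repr_fracE f : f * frac_of (\d_(repr f)) = frac_of (\n_(repr f)).
Proof.
rewrite /frac_of -{1}[f]reprK; unlock tofrac; rewrite -[LHS]FracField.pi_mul.
apply/eqmodP; rewrite /= FracField.equivfE /FracField.mulf.
have d0 : \d_(repr f) != 0 := denom_ratioP _.
by rewrite !numden_Ratio ?oner_eq0 // ?mulr1 // mulrC.
Qed.

Lemma ratden_neq0 f : ratden f != 0.
Proof.
have d0 : \d_(repr f) != 0 := denom_ratioP _.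
by rewrite /ratden dvdp_div_eq0 ?dvdp_gcdr.
Qed.

Lemma rat_coprime f : coprimep (ratnum f) (ratden f).
Proof. by rewrite coprimep_div_gcd // (denom_ratioP (repr f)) orbT. Qed.

Lemma frac_of_eq0 p : (frac_of p == 0) = (p == 0).
Proof. exact: tofrac_eq0. Qed.

Lemma frac_ofM p q : frac_of (p * q) = frac_of p * frac_of q.
Proof. exact: rmorphM. Qed.

Lemma ratfunE f : f = frac_of (ratnum f) / frac_of (ratden f).
Proof.
have d0 : \d_(repr f) != 0 := denom_ratioP _.
have g0 : gcdp \n_(repr f) \d_(repr f) != 0 by rewrite gcdp_eq0 negb_and d0 orbT.
have D0 : frac_of (ratden f) != 0 by rewrite frac_of_eq0 ratden_neq0.
apply: (mulIf D0); rewrite divfK //.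
have G0 : frac_of (gcdp \n_(repr f) \d_(repr f)) != 0 by rewrite frac_of_eq0.
apply: (mulIf G0); rewrite -mulrA -!frac_ofM /ratnum /ratden.
by rewrite !divpK ?dvdp_gcdl ?dvdp_gcdr // repr_fracE.
Qed.

(** A Bezout relation for [p, q] shows that the reduced pair of the quotient is [h] times [(p, q)];
    [h] divides two coprime polynomials, so it is constant. *)
Lemma ratnumden_frac p q : q != 0 -> coprimep p q -> exists2 u, u != 0 &
  ratnum (frac_of p / frac_of q) = u *: p /\ ratden (frac_of p / frac_of q) = u *: q.
Proof.
move=> q0 cpq; set f := _ / _; set a := ratnum f; set b := ratden f.
have b0 : b != 0 := ratden_neq0 f.
have E : a * q = p * b.
  apply/eqP; rewrite -subr_eq0 -frac_of_eq0 /frac_of rmorphB /= subr_eq0 -!/(frac_of _).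
  rewrite !frac_ofM -(inj_eq (mulIf (_ : (frac_of b)^-1 != 0))) ?invr_eq0 ?frac_of_eq0 //.
  by rewrite mulfK ?frac_of_eq0 // mulrAC -ratfunE divfK ?frac_of_eq0.
have /Bezout_eq1_coprimepP[[v w] /= vw] := cpq.
pose h := v * a + w * b.
have hp : a = h * p by rewrite /h mulrDl -!mulrA [b * p]mulrC -E -[LHS]mul1r -vw; ring.
have hq : b = h * q by rewrite /h mulrDl -!mulrA E -[LHS]mul1r -vw; ring.
have h1 : size h == 1%N.
  rewrite -dvdp1 -(eqp_dvdr _ (_ : gcdp a b %= 1)); last first.
    by rewrite -size_poly_eq1; apply: rat_coprime.
  by rewrite dvdp_gcd hp hq !dvdp_mulr.
have h0 : h != 0 by rewrite -size_poly_eq0 (eqP h1).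
have hE := size1_polyC (eq_leq (eqP h1)).
exists h`_0; first by rewrite -polyC_eq0 -hE.
by split; rewrite -mul_polyC -hE.
Qed.

Lemma horner_ratconst d p r s : (size p <= d.+1)%N -> s != 0 ->
  (map_poly (@ratconst F) p).[frac_of r / frac_of s] * frac_of s ^+ d
  = frac_of (heval d (map_poly polyC p) r s).
Proof.
move=> sp s0; have S0 : frac_of s != 0 by rewrite frac_of_eq0.
rewrite (@horner_coef_wide _ d.+1); last exact: leq_trans (size_poly _ _) _.
rewrite mulr_suml /heval /frac_of rmorph_sum; apply: eq_bigr => i _ /=.
rewrite coef_map_id0; last by rewrite /ratconst /frac_of polyC0 tofrac0.
rewrite coef_map /= !rmorphM !rmorphXn /= /ratconst /frac_of expr_div_n.
have -> : tofrac s ^+ d = tofrac s ^+ i * tofrac s ^+ (d - i).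
  by rewrite -exprD subnKC // -ltnS.
by apply: mul_div_cancel; rewrite expf_eq0 (negPf S0) andbF.
Qed.

Lemma ratcomp_frac d p q r s : q != 0 -> coprimep p q -> s != 0 ->
  (size p <= d.+1)%N -> (size q <= d.+1)%N ->
  ratcomp (frac_of p / frac_of q) (frac_of r / frac_of s) =
  frac_of (heval d (map_poly polyC p) r s) / frac_of (heval d (map_poly polyC q) r s).
Proof.
move=> q0 cpq s0 sp sq; rewrite /ratcomp; have [u u0 [-> ->]] := ratnumden_frac q0 cpq.
have S0 : frac_of s ^+ d != 0 by rewrite expf_eq0 frac_of_eq0 (negPf s0) andbF.
have U0 : frac_of u%:P != 0 by rewrite frac_of_eq0 polyC_eq0.
have hZ (a : {poly F}) : (size a <= d.+1)%N ->
    (map_poly (@ratconst F) (u *: a)).[frac_of r / frac_of s] * frac_of s ^+ d =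
    frac_of u%:P * frac_of (heval d (map_poly polyC a) r s).
  move=> sa; rewrite horner_ratconst //; last exact: leq_trans (size_scale_leq _ _) _.
  by rewrite map_polyZ hevalZ /= frac_ofM.
exact: eq_div_common U0 S0 (hZ p sp) (hZ q sq).
Qed.

Definition hom (c : P1 F) : F * F := if c is Some x then (x, 1) else (1, 0).

Lemma hom_neq0 c : hom c != (0, 0).
Proof. by case: c => [x|]; rewrite xpair_eqE oner_eq0 ?andbF. Qed.

Lemma hom_inj c c' : wedge (hom c) (hom c') = 0 -> c = c'.
Proof.
case: c c' => [x|] [y|]; rewrite /wedge /= ?mulr1 ?mul1r ?mulr0 ?mul0r ?subr0 ?sub0r => /eqP //.
- by rewrite subr_eq0 => /eqP->.
- by rewrite oppr_eq0 oner_eq0.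
- by rewrite oner_eq0.
Qed.

Lemma nondeg_neq0 d p q : nondeg d p q ->
  (exists x y, heval d p x y = 0 /\ (x, y) != (0, 0)) -> q != 0.
Proof.
move=> nd [x [y [pxy xy]]]; apply: contraNneq xy => q0.
by have [|-> ->] := nd x y pxy; first by rewrite q0 heval0.
Qed.

Lemma rateval_frac d p q c : nondeg d p q -> coprimep p q -> q != 0 ->
  (size p <= d.+1)%N -> (size q <= d.+1)%N ->
  exists2 u, u != 0 & fmap d p q (hom c) = scale2 u (hom (rateval (frac_of p / frac_of q) c)).
Proof.
move=> nd cpq q0 sp sq; have [e e0 [En Ed]] := ratnumden_frac q0 cpq.
have key (a b : F) : (a, b) != (0, 0) -> exists2 u, u != 0 &
    (a, b) = scale2 u (hom (if e * b == 0 then None else Some (e * a / (e * b)))).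
  move=> ab; rewrite mulf_eq0 (negPf e0) /=; have [b0|b0] := eqVneq b 0.
    rewrite b0 in ab *; exists a; last by rewrite /scale2 /= mulr1 mulr0.
    by apply: contraNneq ab => ->.
  exists b => //; rewrite /scale2 /= mulr1 -mulf_div divff // mul1r.
  by rewrite mulrC divfK.
have ne := fmap_neq0 nd (hom_neq0 c).
case: c ne => [x|] ne.
  rewrite /rateval En Ed !hornerZ; have := key _ _ ne.
  by rewrite /fmap /= !heval_y1.
have dE : ratdeg (frac_of p / frac_of q) = d.
  rewrite /ratdeg En Ed !size_scale //; apply/eqP; rewrite -eqSS prednK; last first.
    by rewrite leq_max !size_poly_gt0 q0 orbT.
  rewrite eqn_leq geq_max sp sq /= leq_max.
  by case/orP: (nondeg_lead nd) => H; apply/orP; [left|right];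
    rewrite ltnNge; apply: contra H => /leq_sizeP->.
rewrite /rateval dE En Ed !coefZ; have := key _ _ ne.
by rewrite /fmap /= !heval_y0 !expr1n !mulr1.
Qed.

Lemma double_root p x : p != 0 -> p.[x] = 0 -> p^`().[x] = 0 -> (1 < mup x p)%N.
Proof.
move=> p0 px p'x; rewrite mup_geq //.
have /factor_theorem[s Es] : root p x by apply/rootP.
have /factor_theorem[t Et] : root s x.
  by move: p'x; rewrite Es derivM derivXsubC !hornerE subrr mulr0 add0r => /eqP.
by rewrite Es Et -mulrA -expr2 dvdp_mulIr.
Qed.

(** At a finite value [y] the derivative of [p - y q] at [x] is the Wronskian divided by [q(x)]; at
    a pole the Wronskian is [- p(x) q'(x)] with [p(x)] nonzero. Either way a double root appears. *)
Lemma ram_index_fin_frac p q x : q != 0 -> coprimep p q ->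
  (forall y, p != y *: q) -> (wronskian p q).[x] = 0 ->
  (1 < ram_index_fin (frac_of p / frac_of q) x)%N.
Proof.
move=> q0 cpq npq; rewrite /wronskian !hornerE => W.
have p0 : p != 0 by have := npq 0; rewrite scale0r.
have [e e0 [En Ed]] := ratnumden_frac q0 cpq.
rewrite /ram_index_fin /rateval En Ed !hornerZ mulf_eq0 (negPf e0) /=.
case: eqP => [qx|/eqP qx].
  have [|e' e'0 [En' _]] := @ratnumden_frac q p p0; first by rewrite coprimep_sym.
  rewrite invf_div En' double_root ?scaler_eq0 ?negb_or ?e'0 //.
    by rewrite hornerZ qx mulr0.
  have px : p.[x] != 0.
    by apply/eqP => /rootP px; have := coprimep_root cpq px; rewrite qx eqxx.
  rewrite derivZ hornerZ; move: W; rewrite qx mulr0 sub0r => /eqP.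
  by rewrite oppr_eq0 mulf_eq0 (negPf px) => /eqP->; rewrite mulr0.
rewrite -mulf_div divff // mul1r; set y := p.[x] / q.[x].
have -> : frac_of p / frac_of q - ratconst y = frac_of (p - y *: q) / frac_of q.
  have -> : frac_of (p - y *: q) = frac_of p - ratconst y * frac_of q.
    by rewrite -mul_polyC /ratconst /frac_of tofracB tofracM.
  by rewrite mulrBl mulfK // frac_of_eq0.
have [|e' e'0 [En' _]] := @ratnumden_frac (p - y *: q) q q0.
  by rewrite coprimep_sym -mul_polyC -mulNr addrC coprimep_addl_mul coprimep_sym.
rewrite En'; apply: double_root.
- by rewrite scaler_eq0 (negPf e'0) subr_eq0 npq.
- by rewrite !(hornerZ, hornerD, hornerN) /y divfK // subrr mulr0.
rewrite derivZ derivB derivZ !(hornerZ, hornerD, hornerN).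
have -> : p^`().[x] - y * q^`().[x] = (p^`().[x] * q.[x] - p.[x] * q^`().[x]) / q.[x].
  by rewrite /y; field.
by rewrite W mul0r mulr0.
Qed.

Lemma nondeg_not_scale d p q : nondeg d p q ->
  (exists x y, heval d q x y = 0 /\ (x, y) != (0, 0)) -> forall y, p != y *: q.
Proof.
move=> nd [x [x' [qx xx']]] y; apply: contraNneq xx' => E.
by have [|//|-> ->] := nd x x'; first by rewrite E hevalZ qx mulr0.
Qed.

End RationalFunctions.

Lemma critical_of_wronskian (L : closedFieldType) n (p q : {poly L}) c :
  nondeg n.+1 p q -> (size p <= n.+2)%N -> (size q <= n.+2)%N ->
  heval (n + n) (wronskian p q) (hom c).1 (hom c).2 = 0 ->
  critical (frac_of p / frac_of q) c.
Proof.
move=> nd sp sq W.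
have fz (r : {poly L}) := @form_zero L n.+1 r (ltn0Sn n).
have q0 : q != 0 by apply: (nondeg_neq0 nd); apply: fz.
have cpq := nondeg_coprime sp sq nd.
case: c W => [x|] /= W.
  apply: ram_index_fin_frac => //; last by rewrite -(@heval_y1 _ (n + n)) ?size_wronskian.
  by apply: (nondeg_not_scale nd); apply: fz.
rewrite /critical /=.
have X0 : ('X : {poly L}) != 0 by rewrite polyX_eq0.
have -> : (frac_of 'X)^-1 = frac_of 1 / frac_of 'X :> ratfun L.
  by rewrite /frac_of rmorph1 mul1r.
rewrite (@ratcomp_frac _ n.+1) //.
(* The exchange of 0 and infinity: the coordinate [1 / z] is a linear change of variables in the
   forms, and the Wronskian follows the chain rule. *)
pose m : mat2 L := ((0, 1), (1, 0)).
have l1 : 1 = lin1 m :> {poly L} by rewrite /lin1 scale0r add0r.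
have l2 : 'X = lin2 m :> {poly L} by rewrite /lin2 scale1r addr0.
set p' := heval _ _ _ _; set q' := heval _ _ _ _.
have hE (r : {poly L}) x y : heval n.+1 (heval n.+1 (map_poly polyC r) 1 'X) x y = heval n.+1 r y x.
  by rewrite l1 l2 (heval_comp _ _ m (x, y)) /act /= !mul0r !mul1r add0r addr0.
have nd' : nondeg n.+1 p' q'.
  by move=> x y; rewrite !hE => E1 E2; have [-> ->] := nd _ _ E1 E2.
have s' (r : {poly L}) : (size (heval n.+1 (map_poly polyC r) 1 'X) <= n.+2)%N.
  by rewrite size_heval ?size_poly1 ?size_polyX.
have cpq' := nondeg_coprime (s' p) (s' q) nd'.
apply: ram_index_fin_frac => //.
- by apply: (nondeg_neq0 nd'); apply/fz/s'.
- by apply: (nondeg_not_scale nd'); apply/fz/s'.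
rewrite wronskian_heval // hornerM horner_heval hornerC hornerX W mul0r //.
Qed.

(** * Subfields, conjugates and algebraic degree *)

Section Subfield.
Variables (L : fieldType) (S : L -> Prop).
Hypotheses (S1 : S 1) (SB : forall x y, S x -> S y -> S (x - y))
  (Sdiv : forall x y, S x -> S y -> S (x / y)).

Definition subfield_pred : {pred L} := fun x => boolp.asbool (S x).

Fact subfield_divring : divring_closed subfield_pred.
Proof.
split=> [|x y|x y]; rewrite !unfold_in; first exact/boolp.asboolP.
  by move=> /boolp.asboolP Sx /boolp.asboolP Sy; apply/boolp.asboolP/SB.
by move=> /boolp.asboolP Sx /boolp.asboolP Sy; apply/boolp.asboolP/Sdiv.
Qed.

HB.instance Definition _ := GRing.isDivringClosed.Build L subfield_pred subfield_divring.

Record subfield_sub := SubfieldSub { subfield_val : L; _ : subfield_val \in subfield_pred }.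

HB.instance Definition _ := [isSub for subfield_val].
HB.instance Definition _ := [Choice of subfield_sub by <:].
HB.instance Definition _ := [SubChoice_isSubIntegralDomain of subfield_sub by <:].
HB.instance Definition _ := [SubIntegralDomain_isSubField of subfield_sub by <:].

(** Used both for the domain of a partial embedding and for the constants, which must be fields in
    order to carry polynomials and matrices. *)
Lemma subfield_type : exists (E : fieldType) (i : {rmorphism E -> L}),
  forall x, S x <-> exists e, x = i e.
Proof.
exists subfield_sub, (val : {rmorphism subfield_sub -> L}) => x; split.
  move=> Sx; have xS : x \in subfield_pred by rewrite unfold_in; apply/boolp.asboolP.
  by exists (SubfieldSub xS).
by case=> [[y yS]] ->; apply/boolp.asboolP.
Qed.

End Subfield.

Section Minimal.
Variables (K L : fieldType) (iota : {rmorphism K -> L}).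

Definition minimal_poly (m : {poly K}) (x : L) :=
  [/\ m != 0, root (map_poly iota m) x &
      forall p, root (map_poly iota p) x -> m %| p].

Lemma minimal_poly_exists x : algebraicOver iota x -> exists m, minimal_poly m x.
Proof.
case=> p p0 px; have [n] := ubnP (size p); elim: n p p0 px => // n IHn p p0 px sp.
have [H|] := boolp.EM (forall q, root (map_poly iota q) x -> p %| q); first by exists p.
move=> /boolp.existsNP[q /boolp.not_implyP[qx pq]].
apply: (IHn (q %% p)); first by rewrite -/(dvdp _ _); apply/negP.
  move: qx; rewrite {1}(divp_eq q p) !rootE rmorphD rmorphM !hornerE (rootP px).
  by rewrite mulr0 add0r.
by rewrite (leq_trans _ (sp : (size p <= n)%N)) // ltn_modp.
Qed.

(** Write [m = s g] with [g] the gcd. As [x] is not a root of [p] it is not one of [g], hence it is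
    a root of [s]; then [m] divides [s] and [g] is constant. *)
Lemma minimal_poly_coprime m x p : minimal_poly m x ->
  ~~ root (map_poly iota p) x -> coprimep m p.
Proof.
move=> [m0 mx mP] px; rewrite /coprimep.
have [s Es] : exists s, m = s * gcdp m p by exists (m %/ gcdp m p); rewrite divpK // dvdp_gcdl.
have : root (map_poly iota (s * gcdp m p)) x by rewrite -Es.
rewrite rmorphM rootM => /orP[/mP ms|/mP mg]; last first.
  have /dvdpP[t Et] := dvdp_trans mg (dvdp_gcdr m p).
  by move: px; rewrite Et rmorphM rootM mx orbT.
have g0 : gcdp m p != 0 by rewrite gcdp_eq0 negb_and m0.
have s0 : s != 0 by apply: contraNneq m0; rewrite Es => ->; rewrite mul0r.
have := dvdp_leq s0 ms; rewrite {1}Es size_mul // -subn1 leq_subLR addnC leq_add2r => sg.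
by rewrite eqn_leq sg size_poly_gt0.
Qed.

Lemma minimal_poly_bezout m x p : minimal_poly m x -> ~~ root (map_poly iota p) x ->
  exists u v, u * m + v * p = 1.
Proof.
by move=> mx px; have /Bezout_eq1_coprimepP[[u v] E] := minimal_poly_coprime mx px; exists u, v.
Qed.

End Minimal.

(** * Partial embeddings as relations, and Zorn's lemma *)

Section Graph.
Variables (K L : fieldType) (iota : {rmorphism K -> L}).

(** The graph of an embedding over [K] of a subfield of [L]; as relations, partial embeddings are
    ordered by inclusion. The last clause makes the relation single-valued and injective. *)
Definition field_graph (G : L -> L -> Prop) :=
  [/\ forall c, G (iota c) (iota c),
      forall x y x' y', G x y -> G x' y' -> G (x - x') (y - y'),
      forall x y x' y', G x y -> G x' y' -> G (x * x') (y * y'),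
      forall x y, G x y -> G x^-1 y^-1
    & forall x y, G x y -> (x == 0) = (y == 0)].

Definition adjoin_graph (E : fieldType) (i g : {rmorphism E -> L}) x y (a b : L) :=
  exists p : {poly E}, a = (map_poly i p).[x] /\ b = (map_poly g p).[y].

(** A polynomial over [E] vanishes at [x] exactly when its image under [g] vanishes at [y]: it is a
    multiple of [m] or, by Bezout, invertible modulo [m]. Bezout also supplies the inverses. *)
Lemma adjoin_graphP (E : fieldType) (i g : {rmorphism E -> L}) m x y :
  (forall c, exists e, iota c = i e /\ iota c = g e) ->
  minimal_poly i m x -> root (map_poly g m) y -> field_graph (adjoin_graph i g x y).
Proof.
move=> HK mx my; have [m0 rmx mP] := mx.
have zero p : ((map_poly i p).[x] == 0) = ((map_poly g p).[y] == 0).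
  apply/idP/idP => [/mP/dvdpP[q ->]|py].
    by rewrite rmorphM hornerM (rootP my) mulr0.
  apply: contraT => /(minimal_poly_bezout mx)[u [v /(congr1 (map_poly g)) uv]].
  have := congr1 (fun p : {poly L} => p.[y]) uv.
  rewrite rmorphD !rmorphM rmorph1 !hornerE (rootP my) (eqP py) !mulr0 addr0 => /eqP.
  by rewrite eq_sym oner_eq0.
split.
- by move=> c; have [e [E1 E2]] := HK c; exists e%:P; rewrite !map_polyC !hornerC.
- move=> _ _ _ _ [p [-> ->]] [q [-> ->]]; exists (p - q).
  by rewrite !rmorphB !hornerE.
- move=> _ _ _ _ [p [-> ->]] [q [-> ->]]; exists (p * q).
  by rewrite !rmorphM !hornerE.
- move=> _ _ [p [-> ->]]; have [p0|p0] := eqVneq (map_poly i p).[x] 0.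
    have := zero p; rewrite p0 eqxx => /esym/eqP->; exists 0.
    by rewrite invr0 !rmorph0 !horner0.
  have [u [v uv]] := minimal_poly_bezout mx p0; exists v.
  have Ev (h : {rmorphism E -> L}) z : root (map_poly h m) z ->
      (map_poly h v).[z] * (map_poly h p).[z] = 1.
    move=> mz; have := congr1 (fun p : {poly E} => (map_poly h p).[z]) uv.
    by rewrite rmorphD !rmorphM rmorph1 !hornerE (rootP mz) mulr0 add0r.
  have p1 : (map_poly g p).[y] != 0 by rewrite -zero.
  by split; [apply: (mulIf p0) | apply: (mulIf p1)]; rewrite mulVf // Ev.
- by move=> _ _ [p [-> ->]].
Qed.

Lemma field_graph_fun G x y y' : field_graph G -> G x y -> G x y' -> y = y'.
Proof.
move=> [_ GB _ _ G0] Gxy Gxy'; have := G0 _ _ (GB _ _ _ _ Gxy Gxy').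
by rewrite subrr eqxx => /esym; rewrite subr_eq0 => /eqP.
Qed.

Lemma field_graph_rmorphism G (E : fieldType) (i : {rmorphism E -> L}) :
  field_graph G -> (forall e, exists y, G (i e) y) ->
  exists g : {rmorphism E -> L}, forall e, G (i e) (g e).
Proof.
move=> HG /boolp.choice[g gP]; have [GK GB GM GV G0] := HG.
have ga : zmod_morphism g.
  move=> e e'; apply: (field_graph_fun HG (gP _)); rewrite rmorphB; exact: GB.
have gm : monoid_morphism g.
  split=> [|e e']; apply: (field_graph_fun HG (gP _)).
    by rewrite rmorph1 -(rmorph1 iota); apply: GK.
  by rewrite rmorphM; apply: GM.
pose g' : {rmorphism E -> L} := HB.pack g
  (GRing.isZmodMorphism.Build E L g ga) (GRing.isMonoidMorphism.Build E L g gm).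
by exists g'.
Qed.

Lemma field_graph_maximal G0 : field_graph G0 -> exists G,
  [/\ field_graph G, forall x y, G0 x y -> G x y &
      forall G', field_graph G' -> (forall x y, G x y -> G' x y) ->
      forall x y, G' x y -> G x y].
Proof.
move=> HG0.
pose T := {G : L -> L -> Prop | field_graph G /\ (forall x y, G0 x y -> G x y)}.
pose t0 : T := exist _ G0 (conj HG0 (fun _ _ h => h)).
pose R (s t : T) : bool := boolp.asbool (forall x y, sval s x y -> sval t x y).
have [|r s t /boolp.asboolP rs /boolp.asboolP st|A Atot|[G [HG GG0]] Gmax] :=
  @classical_sets.ZL_preorder T t0 R.
- by move=> t; apply/boolp.asboolP.
- by apply/boolp.asboolP => x y /rs/st.
(* A nonempty chain is bounded by the union of its members, the empty one by [G0]. *)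
- have [[s0 As0]|A0] := boolp.EM (exists s, A s); last first.
    by exists t0 => s As; case: A0; exists s.
  pose U x y := exists2 s : T, A s & sval s x y.
  have U2 x y x' y' : U x y -> U x' y' -> exists2 s : T, A s & sval s x y /\ sval s x' y'.
    move=> [s As sxy] [s' As' sxy'].
    by have [/boolp.asboolP ss|/boolp.asboolP ss] := Atot _ _ As As';
      [exists s' | exists s] => //; split=> //; apply: ss.
  have gr (s : T) : field_graph (sval s) by case: s => s [].
  have HU : field_graph U.
    split.
    - by move=> c; exists s0 => //; have [GK _ _ _ _] := gr s0; apply: GK.
    - move=> x y x' y' /U2 H /H[s As [sx sx']]; exists s => //.
      by have [_ GB _ _ _] := gr s; apply: GB.
    - move=> x y x' y' /U2 H /H[s As [sx sx']]; exists s => //.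
      by have [_ _ GM _ _] := gr s; apply: GM.
    - move=> x y [s As sx]; exists s => //; have [_ _ _ GV _] := gr s; exact: GV.
    - by move=> x y [s As sx]; have [_ _ _ _ G00] := gr s; apply: G00.
  have U0 x y : G0 x y -> U x y by move=> h; exists s0 => //; apply: (proj2 (svalP s0)).
  exists (exist _ U (conj HU U0)) => s As; apply/boolp.asboolP => x y sx /=.
  by exists s.
exists G; split=> // G' HG' GG' x y.
have HT : field_graph G' /\ (forall x y, G0 x y -> G' x y).
  by split=> // a b /GG0/GG'.
by have /boolp.asboolP := Gmax (exist _ G' HT) (introT (boolp.asboolP _) GG'); apply.
Qed.

End Graph.

Section Closure.
Variables (K : fieldType) (L : closedFieldType) (iota : {rmorphism K -> L}).
Hypothesis K_alg : forall x, algebraicOver iota x.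

Lemma minimal_poly_size (E : fieldType) (i : {rmorphism E -> L}) m x :
  minimal_poly i m x -> (1 < size m)%N.
Proof.
move=> [m0 mx _]; rewrite ltnNge; apply: contraL mx => s1.
rewrite (size1_polyC s1) map_polyC rootC fmorph_eq0; apply: contra m0 => /eqP E0.
by rewrite (size1_polyC s1) E0.
Qed.

(** Extend the embedding sending [a] to [b] to a maximal one. Any [x] is algebraic over its domain,
    and the image of its minimal polynomial has a root in [L], so by maximality [x] is already in
    the domain. *)
Lemma conjugate_embedding m a b : minimal_poly iota m a -> root (map_poly iota m) b ->
  exists s : {rmorphism L -> L}, (forall c, s (iota c) = iota c) /\ s a = b.
Proof.
move=> ma mb.
have HK c : exists e, iota c = iota e /\ iota c = iota e by exists c.
have [G [HG GG0 Gmax]] := field_graph_maximal (adjoin_graphP HK ma mb).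
have [GK GB GM GV G0] := HG.
have Gtot x : exists y, G x y.
  have [|||E [i iP]] := @subfield_type L (fun x => exists y, G x y).
  - by exists 1; rewrite -(rmorph1 iota).
  - by move=> u v [u' Gu] [v' Gv]; exists (u' - v'); apply: GB.
  - by move=> u v [u' Gu] [v' Gv]; exists (u' / v'); apply: GM => //; apply: GV.
  have [|g gP] := @field_graph_rmorphism _ _ iota G E i HG; first by move=> e; apply/iP; exists e.
  have /boolp.choice[h hP] : forall c, exists e, iota c = i e.
    by move=> c; apply/iP; exists (iota c).
  have x_alg : algebraicOver i x.
    have [p p0 px] := K_alg x.
    have h0 : h 0 = 0 by apply: (fmorph_inj i); rewrite -hP !rmorph0.
    have Ep : map_poly i (map_poly h p) = map_poly iota p.
      by apply/polyP => k; rewrite coef_map coef_map_id0 // coef_map /= hP.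
    exists (map_poly h p); last by rewrite Ep.
    by rewrite -(map_poly_eq0 i) Ep map_poly_eq0.
  have [mx mxP] := minimal_poly_exists x_alg.
  have [y yP] : exists y, root (map_poly g mx) y.
    by apply: closed_root; rewrite size_map_poly; apply: minimal_poly_size mxP.
  have HKE c : exists e, iota c = i e /\ iota c = g e.
    exists (h c); split=> //; apply: (field_graph_fun HG (GK c)).
    by rewrite {1}hP; apply: gP.
  exists y; apply: (Gmax _ (adjoin_graphP HKE mxP yP)).
    move=> u v Guv; have /iP[e Ee] : exists v, G u v by exists v.
    exists e%:P; rewrite !map_polyC !hornerC /=; split=> //.
    by apply: (field_graph_fun HG Guv); rewrite Ee; apply: gP.
  by exists 'X; rewrite !map_polyX !hornerX.
have [s sP] := field_graph_rmorphism (i := idfun) HG Gtot.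
exists s; split=> [c|]; first by apply: (field_graph_fun HG (sP _)); apply: GK.
apply: (field_graph_fun HG (sP _)); apply: GG0.
by exists 'X; rewrite !map_polyX !hornerX.
Qed.

(** An embedding over [K] injects the finite set of roots of a polynomial over [K] into itself,
    hence permutes it. *)
Lemma embedding_surjective (s : {rmorphism L -> L}) : (forall c, s (iota c) = iota c) ->
  forall y, exists x, s x = y.
Proof.
move=> sK y; have [p p0 py] := K_alg y.
have [r Er] := closed_field_poly_normal (map_poly iota p).
have rP z : (z \in undup r) = root (map_poly iota p) z.
  by rewrite mem_undup Er rootZ ?root_prod_XsubC // lead_coef_eq0 map_poly_eq0.
have ss : {subset map s (undup r) <= undup r}.
  move=> _ /mapP[z zr ->]; move: zr; rewrite !rP !rootE => /eqP pz.
  have -> : map_poly iota p = map_poly s (map_poly iota p).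
    by apply/polyP => k; rewrite !coef_map /= sK.
  by rewrite horner_map pz rmorph0.
have us : uniq (map s (undup r)) by rewrite map_inj_uniq ?undup_uniq //; apply: fmorph_inj.
have [_ E] := uniq_min_size us ss (eq_leq (esym (size_map _ _))).
have : y \in map s (undup r) by rewrite E rP.
by case/mapP=> x _ ->; exists x.
Qed.

Lemma embedding_Gal (s : {rmorphism L -> L}) : (forall c, s (iota c) = iota c) ->
  in_Gal_sep iota s.
Proof.
move=> sK.
have sp p : map_poly iota p = map_poly s (map_poly iota p).
  by apply/polyP => k; rewrite !coef_map /= sK.
split=> //.
- move=> x [p p_sep px]; exists p => //.
  by rewrite sp rootE horner_map (rootP px) rmorph0.
- move=> y [p p_sep py]; have [x xy] := embedding_surjective sK y; exists x => //.
  exists p => //; move: py; rewrite sp -xy rootE horner_map fmorph_eq0 -sp; exact.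
- by move=> *; rewrite rmorphD.
- by move=> *; rewrite rmorphM.
Qed.

Lemma minimal_poly_root m a b : minimal_poly iota m a -> root (map_poly iota m) b ->
  minimal_poly iota m b.
Proof.
move=> ma mb; have [m0 _ mP] := ma; split=> // p pb; apply: mP; apply: contraT.
move=> /(minimal_poly_bezout ma)[u [v /(congr1 (fun q => (map_poly iota q).[b]))]].
rewrite rmorphD !rmorphM rmorph1 !hornerE (rootP mb) (rootP pb) !mulr0 addr0 => /eqP.
by rewrite eq_sym oner_eq0.
Qed.

(** Bezout inverts [q(a)] inside [K[a]], so that [K(a) = K[a]], and reduction modulo [m] gives the
    basis of the first [(size m).-1] powers of [a]. *)
Lemma alg_degree_minimal m a : minimal_poly iota m a ->
  alg_degree iota (Some a) (size m).-1.
Proof.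
move=> ma; have [m0 mroot mP] := ma; have sm := minimal_poly_size ma.
set n := (size m).-1; have smE : size m = n.+1 by rewrite prednK // ltnW.
have evE (c : 'rV[K]_n) : \sum_(i < n) iota (c 0 i) * a ^+ i = (map_poly iota (rVpoly c)).[a].
  rewrite (@horner_coef_wide _ n); last by rewrite size_map_poly size_poly.
  by apply: eq_bigr => i _; rewrite coef_map coef_rVpoly_ord.
exists (fun i : 'I_n => a ^+ i); split=> [i|x].
  by exists 'X^i, 1; rewrite !rmorph1 hornerC oner_neq0 invr1 mulr1 map_polyXn hornerXn.
case=> p [q [qa ->]].
have [u [v uv]] := minimal_poly_bezout ma qa.
have Ev : (map_poly iota v).[a] * (map_poly iota q).[a] = 1.
  have := congr1 (fun p => (map_poly iota p).[a]) uv.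
  by rewrite rmorphD !rmorphM rmorph1 !hornerE (rootP mroot) mulr0 add0r.
have -> : (map_poly iota p).[a] / (map_poly iota q).[a] = (map_poly iota ((p * v) %% m)).[a].
  apply: (mulIf qa); rewrite divfK //.
  transitivity ((map_poly iota (p * v)).[a] * (map_poly iota q).[a]).
    by rewrite rmorphM hornerM -mulrA Ev mulr1.
  congr (_ * _); rewrite {1}(divp_eq (p * v) m) rmorphD rmorphM !hornerE.
  by rewrite (rootP mroot) mulr0 add0r.
have sr : (size ((p * v) %% m)%R <= n)%N by rewrite -ltnS -smE ltn_modp.
exists (poly_rV ((p * v) %% m)); split; first by rewrite evE poly_rV_K.
move=> c; rewrite evE => E; rewrite -[c]rVpolyK; congr poly_rV.
apply/eqP; rewrite -subr_eq0; apply: contraT => ne.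
have /mP/(dvdp_leq ne) : root (map_poly iota ((p * v) %% m - rVpoly c)) a.
  by rewrite rmorphB rootE !hornerE E subrr.
by rewrite smE leqNgt ltnS (leq_trans (size_polyD _ _)) // size_polyN geq_max sr size_poly.
Qed.

Lemma alg_degree_inf : alg_degree iota None 1.
Proof.
exists (fun=> 1); split=> [i|x [c ->]]; first by exists 1; rewrite rmorph1.
exists (\row_i c); split; first by rewrite big_ord1 mxE mulr1.
move=> c'; rewrite big_ord1 mulr1 => /fmorph_inj E.
by apply/rowP => i; rewrite !mxE ord1.
Qed.

(** As m'(a) is nonzero, m' is coprime to [m]. The roots of [m] are then simple, and each is the
    image of any other under an embedding over [K]. *)
Lemma separable_orbit m a : minimal_poly iota m a -> (map_poly iota m^`()).[a] != 0 ->
  exists r : seq L, [/\ uniq r, size r = (size m).-1, a \in r &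
    forall b, b \in r -> Gal_conjugate iota (Some a) (Some b)] /\
    (forall (s : {rmorphism L -> L}) b, (forall c, s (iota c) = iota c) -> b \in r -> s b \in r) /\
    (forall b c, b \in r -> c \in r ->
      exists s : {rmorphism L -> L}, (forall c, s (iota c) = iota c) /\ s b = c).
Proof.
move=> ma m'a; have [m0 mroot mP] := ma.
have m_sep : separable_poly m by rewrite unlock; apply: (minimal_poly_coprime ma).
have [r Er] := closed_field_poly_normal (map_poly iota m).
have lc0 : lead_coef (map_poly iota m) != 0 by rewrite lead_coef_eq0 map_poly_eq0.
have rP z : (z \in r) = root (map_poly iota m) z by rewrite Er rootZ // root_prod_XsubC.
exists r; split; [split|split].
- rewrite -separable_prod_XsubC -(separable_map iota) in m_sep *.
  by move: m_sep; rewrite Er (eqp_separable (eqp_scale _ lc0)).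
- by rewrite -(size_map_poly iota) Er size_scale // size_prod_XsubC.
- by rewrite rP.
- move=> b; rewrite rP => mb; split=> [_ [<-]|]; first by exists m.
  have [s [sK sab]] := conjugate_embedding ma mb.
  by exists s; [apply: embedding_Gal | rewrite /= sab].
- move=> s b sK; rewrite !rP => mb.
  have -> : map_poly iota m = map_poly s (map_poly iota m).
    by apply/polyP => k; rewrite !coef_map /= sK.
  by rewrite rootE horner_map (rootP mb) rmorph0.
- by move=> b c; rewrite !rP => mb; apply: conjugate_embedding; apply: minimal_poly_root ma mb.
Qed.

End Closure.

(** * Galois orbits in the fibres of the iterates *)

Lemma sum_fibres (A B : eqType) (g : A -> B) (s : seq A) :
  (\sum_(y <- undup (map g s)) count (fun x => g x == y) s)%N = size s.
Proof.
under eq_bigr => y _ do rewrite -sum1_count big_mkcond.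
rewrite exchange_big /= -sum1_size; apply: eq_big_seq => x xs.
rewrite -big_mkcond /= sum1_count -(@eq_count _ (pred1 (g x))); last by move=> y; rewrite /= eq_sym.
by rewrite count_uniq_mem ?undup_uniq // mem_undup map_f.
Qed.

Lemma size_leq_fibres (A B : eqType) (g : A -> B) (s : seq A) b :
  (forall y, (count (fun x => g x == y) s <= b)%N) ->
  (size s <= b * size (undup (map g s)))%N.
Proof.
move=> H; rewrite -(sum_fibres g) -sum1_size big_distrr /=.
by apply: leq_sum => y _; rewrite muln1.
Qed.

Section Fibres.
Variables (L : closedFieldType) (n : nat) (P Q : {poly L}).
Hypotheses (sP : (size P <= n.+2)%N) (sQ : (size Q <= n.+2)%N).
Hypothesis PQ_nondeg : nondeg n.+1 P Q.

Local Notation F := (fmap n.+1 P Q).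
Local Notation f := (rateval (frac_of P / frac_of Q)).

Lemma Q_neq0 : Q != 0.
Proof. by apply: (nondeg_neq0 PQ_nondeg); apply: form_zero. Qed.

Lemma P_not_scale y : P != y *: Q.
Proof. by apply: (nondeg_not_scale PQ_nondeg); apply: form_zero. Qed.

Lemma rateval_hom c : exists2 u, u != 0 & F (hom c) = scale2 u (hom (f c)).
Proof.
by apply: rateval_frac => //; [exact: nondeg_coprime sP sQ PQ_nondeg | exact: Q_neq0].
Qed.

Lemma rateval_wedge c c' : wedge (hom c') (F (hom c)) = 0 -> f c = c'.
Proof.
have [u u0 ->] := rateval_hom c => E; apply/esym/hom_inj/(mulfI u0).
by rewrite mulr0 -E /wedge /scale2 /=; ring.
Qed.

Lemma wedge_rateval c : wedge (hom (f c)) (F (hom c)) = 0.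
Proof. by have [u u0 ->] := rateval_hom c; rewrite /wedge /scale2 /=; ring. Qed.

Lemma fibre_size (s : seq (P1 L)) y : uniq s -> {in s, forall c, f c = y} -> (size s <= n.+1)%N.
Proof.
move=> us sy; pose h := (hom y).1 *: Q - (hom y).2 *: P.
have sh : (size h <= n.+2)%N.
  rewrite (leq_trans (size_polyD _ _)) // size_polyN geq_max.
  by rewrite !(leq_trans (size_scale_leq _ _)).
have hE v : heval n.+1 h v.1 v.2 = wedge (hom y) (F v) by rewrite hevalB !hevalZ.
have h0 : h != 0.
  rewrite /h; case: y {sy h sh hE} => [y|] /=.
    by rewrite scale1r subr_eq0 eq_sym P_not_scale.
  by rewrite scale1r scale0r subr0 Q_neq0.
have hs c : c \in s -> heval n.+1 h (hom c).1 (hom c).2 = 0.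
  by move=> cs; rewrite hE -(sy c cs) wedge_rateval.
have rts : all (root h) (pmap id s).
  apply/allP => x; rewrite mem_pmap => /mapP[c cs cx].
  by have := hs c cs; rewrite -cx /= heval_y1 // => /eqP.
have us' : uniq (pmap id s) by apply: (@pmap_uniq _ _ id Some) => // -[].
have sz : size s = (size (pmap id s) + (None \in s))%N.
  rewrite size_pmap -(count_uniq_mem None us) -(count_predC isSome s); congr (_ + _)%N.
  by apply: eq_count => -[].
have rs := max_poly_roots h0 rts us'.
(* When infinity lies in the fibre, the top coefficient of [h] vanishes, which makes room for the
   extra point. *)
rewrite sz; case: (boolP (None \in s)) => Ns; last first.
  by rewrite addn0 -ltnS (leq_trans rs).
rewrite addn1 (leq_trans rs) //; apply/leq_sizeP => i; rewrite leq_eqVlt => /orP[/eqP<-|ni].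
  by have := hs _ Ns; rewrite /= heval_y0 expr1n mulr1.
by rewrite nth_default // (leq_trans sh).
Qed.

Lemma iter_fibre_size r (s : seq (P1 L)) y : uniq s -> {in s, forall c, iter r f c = y} ->
  (size s <= n.+1 ^ r)%N.
Proof.
elim: r s => [|r IHr] s us sy.
  rewrite expn0 -(size_nseq 1 y) uniq_leq_size // => c cs.
  by rewrite inE -(sy c cs).
rewrite expnS (leq_trans (@size_leq_fibres _ _ f s n.+1 _)) //; last first.
  rewrite leq_mul2l IHr ?undup_uniq ?orbT // => c; rewrite mem_undup => /mapP[c' c's ->].
  by rewrite -iterSr sy.
move=> z; rewrite -size_filter (@fibre_size _ z) ?filter_uniq // => c.
by rewrite mem_filter => /andP[/eqP].
Qed.

End Fibres.

(** * Galois orbits with constant cross-ratios along the iterates *)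

Section Orbits.
Variables (K : fieldType) (L : closedFieldType) (iota : {rmorphism K -> L}).
Variables (k0 : fieldType) (j : {rmorphism k0 -> L}).
Hypothesis rel_closed : forall (p : {poly k0}) (x : L),
  p != 0 -> root (map_poly j p) x -> exists c, x = j c.
Variables (n : nat) (p0 q0 : {poly K}).
Local Notation P := (map_poly iota p0).
Local Notation Q := (map_poly iota q0).
Hypotheses (n_gt0 : (0 < n)%N) (sP : (size P <= n.+2)%N) (sQ : (size Q <= n.+2)%N).
Hypothesis PQ_nondeg : nondeg n.+1 P Q.

Local Notation F := (fmap n.+1 P Q).
Local Notation f := (rateval (frac_of P / frac_of Q)).

Definition K_fixing (s : {rmorphism L -> L}) := forall c, s (iota c) = iota c.

Lemma rateval_K_fixing s c : K_fixing s -> f (omap s c) = omap s (f c).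
Proof.
move=> sK; apply: (rateval_wedge sP sQ PQ_nondeg).
have homs c' : hom (omap s c') = (s (hom c').1, s (hom c').2).
  by case: c' => [x|] /=; rewrite ?rmorph1 ?rmorph0.
have Fs v : F (s v.1, s v.2) = (s (F v).1, s (F v).2).
  have smap p : map_poly s (map_poly iota p) = map_poly iota p.
    by apply/polyP => i; rewrite !coef_map /= sK.
  by rewrite /fmap /= !heval_map !smap.
rewrite !homs Fs; have := wedge_rateval sP sQ PQ_nondeg c.
by move=> /(congr1 s); rewrite /wedge /= rmorphB !rmorphM rmorph0.
Qed.

Definition K_orbit (T : seq L) :=
  (forall s t, K_fixing s -> t \in T -> s t \in T) /\
  (forall t t', t \in T -> t' \in T -> exists s, K_fixing s /\ s t = t').

Definition constant_cross_ratios (T : seq L) := forall t1 t2 t3 t4,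
  [/\ t1 \in T, t2 \in T, t3 \in T & t4 \in T] -> uniq [:: t1; t2; t3; t4] ->
  exists c, ((t1 - t4) * (t2 - t3)) / ((t1 - t3) * (t2 - t4)) = j c.

(** Points of [T] are required to be finite in the chart, so that they can serve as sample points
    [(j a, 1)]. *)
Definition chart_of (mu : mat2 L) (T : seq L) := det2 mu != 0 /\
  forall t, t \in T -> exists a, exists2 u, u != 0 & act mu (t, 1) = scale2 u (j a, 1).

(** The cross-ratio with three fixed points of [T] is a coordinate sending them to 0, infinity and
    1, in which all of [T] is constant. *)
Lemma chart_exists T : uniq T -> (2 < size T)%N -> constant_cross_ratios T ->
  exists mu, chart_of mu T.
Proof.
case: T => [|t1 [|t2 [|t3 T']]] // uT _; set T := [:: t1, t2, t3 & T'] => cT.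
have [t12 t13 t23] : [/\ t1 != t2, t1 != t3 & t2 != t3].
  by move: uT => /=; rewrite !inE !negb_or => /and4P[/and3P[? ? _] /andP[? _] _ _].
have [w12 w13 w23] : [/\ t1 - t2 != 0, t1 - t3 != 0 & t2 - t3 != 0] by rewrite !subr_eq0.
pose m : mat2 L := ((- (t2 - t3), t1 * (t2 - t3)), (- (t1 - t3), t2 * (t1 - t3))).
have m0 : det2 m != 0.
  have -> : det2 m = (t2 - t3) * (t1 - t3) * (t1 - t2) by rewrite /det2 /=; ring.
  by rewrite !mulf_neq0.
have mE t : act m (t, 1) = ((t1 - t) * (t2 - t3), (t2 - t) * (t1 - t3)).
  by rewrite /act /=; congr pair; ring.
have mc t : t \in T -> cst j (act m (t, 1)).
  move=> tT; rewrite mE.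
  have [->|n1] := eqVneq t t1.
    by exists ((t2 - t1) * (t1 - t3)), 0, 1; rewrite rmorph0 rmorph1; congr pair; ring.
  have [->|n2] := eqVneq t t2; first by rewrite subrr mul0r; apply: cst_inf.
  have [->|n3] := eqVneq t t3.
    by exists ((t1 - t3) * (t2 - t3)), 1, 1; rewrite rmorph1; congr pair; ring.
  have [||c Ec] := cT t1 t2 t3 t.
  - by split=> //; rewrite !inE eqxx ?orbT.
  - by rewrite /= !inE !negb_or t12 t13 t23 eq_sym n1 eq_sym n2 eq_sym n3.
  apply: (div_cst (a := c)).
  by rewrite -Ec; field; rewrite w13 subr_eq0 eq_sym n2.
have /boolp.choice[val valP] : forall t, exists a, t \in T -> (act m (t, 1)).2 != 0 ->
    (act m (t, 1)).1 = (act m (t, 1)).2 * j a.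
  move=> t; have [tT|] := boolP (t \in T); last by exists 0.
  have := mc t tT; case: (act m (t, 1)) => x y ct /=.
  have [->|y0] := eqVneq y 0; first by exists 0.
  by have [a Ea] := cst_div y0 ct; exists a => _ _; rewrite -Ea mulrC divfK.
(* The further change [z -> 1 / (z - c)], with [c] none of the finite values, makes every value
   finite. *)
have [c cT'] := constants_infinite rel_closed (map val T).
exists (mul2 ((0, 1), (1, - j c)) m); split.
  rewrite det2_mul2 mulf_neq0 //.
  by rewrite /det2 /= mul0r mulr1 sub0r oppr_eq0 oner_eq0.
move=> t tT; rewrite act_mul2.
have : act m (t, 1) != (0, 0) by rewrite act_eq0 // xpair_eqE oner_eq0 andbF.
have := valP t tT; have : val t != c by apply: contraNneq cT' => <-; apply: map_f.
case: (act m (t, 1)) => x y /= vc H ne.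
have [y0|y0] := eqVneq y 0.
  exists 0, x; last by rewrite y0 rmorph0 /act /scale2 /=; congr pair; ring.
  by apply: contraNneq ne => ->; rewrite y0.
have D0 : j (val t) - j c != 0 by rewrite subr_eq0 (inj_eq (fmorph_inj j)).
exists ((val t - c)^-1), (y * (j (val t) - j c)); first by rewrite mulf_neq0.
rewrite fmorphV rmorphB H // /act /scale2 /=; congr pair; last by ring.
by field.
Qed.

Definition good_orbit r (y : P1 L) (T : seq L) :=
  [/\ uniq T, K_orbit T, {in T, forall t, iter r f (Some t) = y},
      (n.+1 ^ r < 2 * size T)%N & constant_cross_ratios T].

(** By transitivity all fibres of [T] over its image [T'] have the same size [e]. As [e <= d] and
    [T'] has at most [d ^ r] points, [size T > d ^ r.+1 / 2] forces both [2 e > d] and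
    [2 size T' > d ^ r]. *)
Lemma good_orbit_step r y T : (1 < r)%N -> good_orbit r.+1 y T ->
  exists T', good_orbit r y T' /\
    forall mu mu', chart_of mu T -> chart_of mu' T' -> chartmap j n P Q mu mu'.
Proof.
move=> r1 [uT [Tcl Ttr] Ty sT cT].
have d_ge2 : (2 <= n.+1)%N by rewrite ltnS.
(* Hence [T] has more than [2 d] points, as [chartmap_of_points] demands. *)
have big : (4 * n.+1 <= n.+1 ^ r.+1)%N.
  rewrite expnSr leq_mul2r /= (leq_trans (_ : 4 <= n.+1 ^ 2)%N) //.
    by rewrite -[4%N]/(2 ^ 2)%N leq_exp2r.
  by rewrite leq_exp2l.
have sT2 : (n.+1 + n.+1 < size T)%N.
  rewrite addnn -mul2n -(ltn_pmul2l (isT : 0 < 2)%N) mulnA (leq_ltn_trans _ sT) //.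
(* If one point went to infinity, the whole orbit would, and a fibre has at most [d] points. *)
have Tfin t : t \in T -> exists t', f (Some t) = Some t'.
  move=> tT; case E: (f (Some t)) => [t'|]; first by exists t'.
  have allN : {in map Some T, forall c, f c = None}.
    move=> _ /mapP[t' t'T ->]; have [s [sK <-]] := Ttr t t' tT t'T.
    by rewrite (rateval_K_fixing (Some t) sK) E.
  have := fibre_size sP sQ PQ_nondeg (_ : uniq (map Some T)) allN.
  rewrite size_map (map_inj_uniq (fun x y => @Some_inj _ x y)) uT => /(_ isT).
  by rewrite leqNgt (leq_ltn_trans (leq_addr _ _) sT2).
have /boolp.choice[g gP] : forall t, exists t', t \in T -> f (Some t) = Some t'.
  move=> t; have [tT|] := boolP (t \in T); last by exists t.
  by have [t' E] := Tfin t tT; exists t'.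
have gs s t : K_fixing s -> t \in T -> g (s t) = s (g t).
  move=> sK tT; apply: Some_inj; rewrite -gP ?Tcl //.
  by rewrite (rateval_K_fixing (Some t) sK) (gP t tT).
pose T' := undup (map g T); pose fib t' := [seq t <- T | g t == t'].
have inT' t : t \in T -> g t \in T' by move=> tT; rewrite mem_undup map_f.
have T'P t' : t' \in T' -> exists2 t, t \in T & t' = g t by rewrite mem_undup => /mapP.
have fib_le t1 t2 : t1 \in T' -> t2 \in T' -> (size (fib t1) <= size (fib t2))%N.
  move=> /T'P[u1 u1T ->] /T'P[u2 u2T ->]; have [s [sK su]] := Ttr u1 u2 u1T u2T.
  rewrite -(size_map s) uniq_leq_size //.
    by rewrite map_inj_uniq ?filter_uniq //; apply: fmorph_inj.
  move=> z /mapP[t]; rewrite mem_filter => /andP[/eqP gt tT] ->.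
  by rewrite mem_filter Tcl // gs // gt -gs // su eqxx.
have fib_eq t1 t2 : t1 \in T' -> t2 \in T' -> size (fib t1) = size (fib t2).
  by move=> T1 T2; apply/eqP; rewrite eqn_leq !fib_le.
have [t0 t0T] : exists t, t \in T.
  by case: (T) sT2 => // t s _; exists t; rewrite inE eqxx.
pose e := size (fib (g t0)).
have eE t' : t' \in T' -> size (fib t') = e by move=> h; apply: fib_eq => //; apply: inT'.
have sTe : size T = (e * size T')%N.
  rewrite -(sum_fibres g) -sum1_size big_distrr /= muln1; apply: eq_big_seq => t' t'T.
  by rewrite -size_filter eE.
have e_le : (e <= n.+1)%N.
  rewrite /e -(size_map Some); apply: (@fibre_size _ _ _ _ sP sQ PQ_nondeg _ (Some (g t0))).
    by rewrite (map_inj_uniq (fun x y => @Some_inj _ x y)) filter_uniq.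
  by move=> z /mapP[t]; rewrite mem_filter => /andP[/eqP <- tT] ->; apply: gP.
have T'y : {in T', forall t, iter r f (Some t) = y}.
  by move=> _ /T'P[t tT ->]; rewrite -gP // -iterSr Ty.
have sT'le : (size T' <= n.+1 ^ r)%N.
  rewrite -(size_map Some); apply: (@iter_fibre_size _ _ _ _ sP sQ PQ_nondeg r _ y).
    by rewrite (map_inj_uniq (fun x y => @Some_inj _ x y)) undup_uniq.
  by move=> _ /mapP[t tT ->]; apply: T'y.
have e_big : (n.+1 < 2 * e)%N.
  have nr0 : (0 < n.+1 ^ r)%N by rewrite expn_gt0.
  rewrite -(ltn_pmul2r nr0) -expnS (leq_trans sT) // sTe mulnA leq_mul2l sT'le orbT //.
have sT' : (n.+1 ^ r < 2 * size T')%N.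
  rewrite -(ltn_pmul2l (ltn0Sn n)) -expnS (leq_trans sT) // sTe mulnCA.
  by rewrite leq_mul2r e_le orbT.
have sT3 : (2 < size T)%N.
  by rewrite (leq_ltn_trans _ sT2) // (leq_trans d_ge2) // leq_addr.
have avals mu : chart_of mu T -> exists av : L -> k0, {in T &, injective av} /\
    forall t, t \in T -> exists2 u, u != 0 & act (adj2 mu) (j (av t), 1) = scale2 u (t, 1).
  case=> mu0 Hmu.
  have /boolp.choice[av avP] : forall t, exists a, t \in T ->
      exists2 u, u != 0 & act mu (t, 1) = scale2 u (j a, 1).
    move=> t; have [tT|] := boolP (t \in T); last by exists 0.
    by have [a H] := Hmu t tT; exists a.
  have avP' t : t \in T -> exists2 u, u != 0 & act (adj2 mu) (j (av t), 1) = scale2 u (t, 1).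
    move=> tT; have [u u0 E] := avP t tT; exists (det2 mu / u).
      by rewrite mulf_neq0 ?invr_eq0.
    have := adj2_actK mu (t, 1); rewrite E act_scale2.
    case: (act _ _) => x z; rewrite /scale2 /= => -[E1 E2].
    by congr pair; apply: (mulfI u0); rewrite ?E1 ?E2; field.
  exists av; split=> // t t' tT t'T E.
  have [u u0 Eu] := avP' t tT; have [u' u'0 Eu'] := avP' t' t'T.
  move: Eu; rewrite E Eu' /scale2 !mulr1 => -[E1 E2].
  by apply: (mulfI u0); rewrite -E1 -E2.
have Ft t : t \in T -> exists2 u, u != 0 & F (t, 1) = scale2 u (g t, 1).
  by move=> tT; have := rateval_hom sP sQ PQ_nondeg (Some t); rewrite gP.
exists T'; split.
  split=> //; first exact: undup_uniq.
    split=> [s _ sK /T'P[t tT ->]|_ _ /T'P[t tT ->] /T'P[t' t'T ->]].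
      by rewrite -gs // inT' // Tcl.
    by have [s [sK <-]] := Ttr t t' tT t'T; exists s; rewrite gs.
  move=> t1 t2 t3 t4 [T1 T2 T3 T4] ut.
  have [mu chmu] := chart_exists uT sT3 cT; have [mu0 _] := chmu.
  have [av [av_inj avP]] := avals mu chmu.
  (* The target keeps its own coordinate, so [cross_ratio_const] speaks of the elements of [T']
     themselves. *)
  pose id2 : mat2 L := ((1, 0), (0, 1)).
  have id20 : det2 id2 != 0 by rewrite /det2 /= mulr1 mulr0 subr0 oner_eq0.
  have nd := cpoly_nondeg PQ_nondeg mu0 id20.
  have sz1 := size_cpoly1 n P Q mu id2; have sz2 := size_cpoly2 n P Q mu id2.
  pose av' t' := map av (fib t').
  have fibT t' : {subset fib t' <= T} by move=> t; rewrite mem_filter => /andP[].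
  have av_uniq u v : u != v -> uniq (av' u ++ av' v).
    move=> uv; rewrite -map_cat map_inj_in_uniq.
      rewrite cat_uniq !filter_uniq // andbT /=; apply/hasPn => t.
      rewrite !mem_filter => /andP[/eqP-> _]; by rewrite eq_sym (negPf uv).
    by move=> t t'; rewrite !mem_cat => /orP[]/fibT ? /orP[]/fibT ?; apply: av_inj.
  (* Two fibres together have [2 e > d] points, that is, at least [n.+2]. *)
  have av_size u v : u \in T' -> v \in T' -> (n.+2 <= size (av' u ++ av' v))%N.
    by move=> uT' vT'; rewrite size_cat !size_map !eE // addnn -mul2n.
  have av_root t' : {in av' t', forall a,
      (cpoly1 n P Q mu id2).[j a] = t' * (cpoly2 n P Q mu id2).[j a]}.
    move=> z /mapP[t]; rewrite mem_filter => /andP[/eqP gt tT] ->.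
    have [u u0 Eu] := avP t tT; have [w w0 Ew] := Ft t tT.
    have := fmap_cpoly n P Q mu id2 (j (av t), 1); rewrite Eu fmap_scale2 Ew gt.
    rewrite {1}/fmap /= !heval_y1 // /act /scale2 /= => -[-> ->]; ring.
  have [t12 t34] : t1 != t2 /\ t3 != t4.
    by move: ut; rewrite /= !inE !negb_or => /and4P[/and3P[? ? ?] _ ? _].
  have npq : cpoly1 n P Q mu id2 - t2 *: cpoly2 n P Q mu id2 != 0.
    rewrite subr_eq0; apply: (nondeg_not_scale nd); exact: form_zero.
  apply: (cross_ratio_const rel_closed sz1 sz2 ut npq (av_uniq _ _ t12) (av_uniq _ _ t34)
    (av_size _ _ T1 T2) (av_size _ _ T3 T4)); exact: av_root.
move=> mu mu' chmu [mu'0 chmu']; have [mu0 _] := chmu.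
have [av [av_inj avP]] := avals mu chmu.
apply: (@chartmap_of_points _ _ j n P Q PQ_nondeg mu mu' (map av T)) => //.
- by rewrite map_inj_in_uniq.
- by rewrite size_map.
move=> _ /mapP[t tT ->]; have [u u0 ->] := avP t tT; have [w w0 Ew] := Ft t tT.
rewrite fmap_scale2 Ew !act_scale2; have [a [z z0 ->]] := chmu' _ (inT' t tT).
by do 3![apply: cst_scale2]; apply: cst_fin.
Qed.

Lemma orbit_constant_conjugate r y T : (5 < r)%N -> wronskian P Q != 0 -> good_orbit r y T ->
  exists2 m, det2 m != 0 & chartmap j n P Q m m.
Proof.
move=> r5 W0 G0; have chart r' T' : (1 < r')%N -> good_orbit r' y T' -> exists mu, chart_of mu T'.
  move=> r1 [uT _ _ sT cT]; apply: chart_exists => //.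
  rewrite -(ltn_pmul2l (isT : 0 < 2)%N) (leq_ltn_trans _ sT) //.
  rewrite (leq_trans (_ : 4 <= n.+1 ^ 2)%N) //; last by rewrite leq_exp2l // ltnS.
  by rewrite -[4%N]/(2 ^ 2)%N leq_exp2r.
(* Four descents from an exponent of at least 6 end at one of at least 2, where an orbit still has
   the three points that [chart_exists] needs. *)
case: r r5 G0 => [|[|[|[|[|[|r]]]]]] // _ G0.
have [T1 [G1 c01]] := good_orbit_step (isT : 1 < r.+4.+1)%N G0.
have [T2 [G2 c12]] := good_orbit_step (isT : 1 < r.+4)%N G1.
have [T3 [G3 c23]] := good_orbit_step (isT : 1 < r.+3)%N G2.
have [T4 [G4 c34]] := good_orbit_step (isT : 1 < r.+2)%N G3.
have [m0 C0] := chart _ _ (isT : 1 < r.+4.+2)%N G0.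
have [m1 C1] := chart _ _ (isT : 1 < r.+4.+1)%N G1.
have [m2 C2] := chart _ _ (isT : 1 < r.+4)%N G2.
have [m3 C3] := chart _ _ (isT : 1 < r.+3)%N G3.
have [m4 C4] := chart _ _ (isT : 1 < r.+2)%N G4.
apply: (constant_conjugate rel_closed n_gt0 sP sQ PQ_nondeg W0
  (proj1 C0) (proj1 C1) (proj1 C2) (proj1 C3) (proj1 C4)).
- exact: c01. - exact: c12. - exact: c23. - exact: c34.
Qed.

End Orbits.

(** * Separability of preimages of a point that is not post-critical *)

Section Separability.
Variables (K : fieldType) (L : closedFieldType) (iota : {rmorphism K -> L}).
Variables (n : nat) (p0 q0 : {poly K}).
Local Notation P := (map_poly iota p0).
Local Notation Q := (map_poly iota q0).
Hypotheses (sP : (size P <= n.+2)%N) (sQ : (size Q <= n.+2)%N).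
Hypothesis PQ_nondeg : nondeg n.+1 P Q.
Local Notation f := (rateval (frac_of P / frac_of Q)).

(** Numerator and denominator of the iterates over [K], built without cancellation so that the chain
    rule for Wronskians applies. *)
Definition iter_forms i : {poly K} * {poly K} :=
  iter i (fun pq => (heval n.+1 (map_poly polyC p0) pq.1 pq.2,
                     heval n.+1 (map_poly polyC q0) pq.1 pq.2)) ('X, 1).

Lemma eval_iter_forms i a : exists2 u, u != 0 &
  ((map_poly iota (iter_forms i).1).[a], (map_poly iota (iter_forms i).2).[a])
  = scale2 u (hom (iter i f (Some a))).
Proof.
elim: i => [|i [u u0 IHi]].
  by exists 1; rewrite ?oner_eq0 // /scale2 /= map_polyX rmorph1 hornerX hornerC !mul1r.
have [w w0 Ew] := rateval_hom sP sQ PQ_nondeg (iter i f (Some a)).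
exists (u ^+ n.+1 * w); first by rewrite mulf_neq0 ?expf_eq0 ?(negPf u0) ?andbF.
have ev p : (map_poly iota (heval n.+1 (map_poly polyC p) (iter_forms i).1 (iter_forms i).2)).[a]
    = heval n.+1 (map_poly iota p) (map_poly iota (iter_forms i).1).[a]
                               (map_poly iota (iter_forms i).2).[a].
  rewrite heval_map -horner_heval; congr (heval _ _ _ _).[_].
  by apply/polyP => k; rewrite !coef_map /= map_polyC.
rewrite {1 2}/iter_forms iterS /= -/(iter_forms i) !ev.
have := congr1 (fmap n.+1 P Q) IHi; rewrite fmap_scale2 Ew /fmap /= => ->.
by rewrite /scale2 /= !mulrA.
Qed.

(** By the chain rule the Wronskian of the iterate at [a] is a product of Wronskians along the
    orbit, none zero as no orbit point is critical. So the polynomial over [K] cutting out the fibre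
    of [gamma] has a simple root at [a], and [mp] divides it. *)
Lemma separable_preimage m a gamma mp :
  iter m f (Some a) = omap iota gamma ->
  (forall i, (i < m)%N -> ~ critical (frac_of P / frac_of Q) (iter i f (Some a))) ->
  minimal_poly iota mp a -> (map_poly iota mp^`()).[a] != 0.
Proof.
move=> fm ncrit [mp0 mpa mpP].
have W i : (i <= m)%N -> (map_poly iota (wronskian (iter_forms i).1 (iter_forms i).2)).[a] != 0.
  elim: i => [|i IHi] im.
    by rewrite /wronskian /= derivX derivC mulr0 subr0 mulr1 rmorph1 hornerC oner_neq0.
  rewrite {1 2}/iter_forms iterS /= -/(iter_forms i).
  have sp : (size p0 <= n.+2)%N by rewrite -(size_map_poly iota).
  have sq : (size q0 <= n.+2)%N by rewrite -(size_map_poly iota).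
  rewrite wronskian_heval // rmorphM hornerM mulf_neq0 ?IHi ?(ltnW im) //.
  have -> : (map_poly iota (heval (n + n) (map_poly polyC (wronskian p0 q0))
       (iter_forms i).1 (iter_forms i).2)).[a] =
      heval (n + n) (wronskian P Q) (map_poly iota (iter_forms i).1).[a]
                                    (map_poly iota (iter_forms i).2).[a].
    have -> : wronskian P Q = map_poly iota (wronskian p0 q0).
      by rewrite /wronskian rmorphB !rmorphM !deriv_map.
    rewrite heval_map -horner_heval; congr (heval _ _ _ _).[_].
    by apply/polyP => k; rewrite !coef_map /= map_polyC.
  have [u u0 [-> ->]] := eval_iter_forms i a.
  rewrite heval_scale mulf_neq0 ?expf_eq0 ?(negPf u0) ?andbF //.
  by apply/eqP => E; apply: (ncrit i im); apply: (critical_of_wronskian PQ_nondeg sP sQ E).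
have [u u0] := eval_iter_forms m a; rewrite fm => -[E1 E2].
have homK : hom (omap iota gamma) = (iota (hom gamma).1, iota (hom gamma).2).
  by case: gamma {fm E1 E2} => [x|] /=; rewrite ?rmorph1 ?rmorph0.
rewrite homK /= in E1 E2.
pose r := (hom gamma).2 *: (iter_forms m).1 - (hom gamma).1 *: (iter_forms m).2.
have : root (map_poly iota r) a.
  rewrite rootE rmorphB /= !map_polyZ !(hornerD, hornerN, hornerZ) E1 E2.
  by apply/eqP; ring.
move=> /mpP/dvdpP[s Es].
(* The Wronskian at [a] equals [u r'(a)], and [r'(a) = s(a) mp'(a)] since [mp(a) = 0]. *)
have := W m (leqnn _); rewrite /wronskian rmorphB !rmorphM !(hornerD, hornerN, hornerM) E1 E2.
apply: contraNneq => mp'a.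
have : (map_poly iota r^`()).[a] = 0.
  rewrite Es derivM rmorphD !rmorphM !(hornerD, hornerM) mp'a (rootP mpa); ring.
rewrite /r derivB !derivZ rmorphB /= !map_polyZ !(hornerD, hornerN, hornerZ) => E.
by rewrite -(mulr0 u) -E; apply/eqP; ring.
Qed.

End Separability.

(** * From a constant chart to isotriviality *)

Lemma isotrivial_of_chartmap (k : fieldType) (K : fieldExtType (ratfun k))
    (L : closedFieldType) (iota : {rmorphism K -> L}) (phi : ratfun K)
    (k0 : fieldType) (j : {rmorphism k0 -> L}) n m :
  let P := map_poly iota (ratnum phi) in let Q := map_poly iota (ratden phi) in
  (size P <= n.+2)%N -> (size Q <= n.+2)%N -> nondeg n.+1 P Q ->
  (forall a, in_kbar iota (j a)) -> det2 m != 0 -> chartmap j n P Q m m ->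
  isotrivial iota phi.
Proof.
move=> P Q sP sQ nd jk m0 mm.
pose fr (m : mat2 L) := frac_of (lin1 m) / frac_of (lin2 m).
have evl (m' : mat2 L) x : ((lin1 m').[x], (lin2 m').[x]) = act m' (x, 1).
  by rewrite /lin1 /lin2 /act /= !(hornerD, hornerZ, hornerX, hornerC) !mulr1.
have l2 (m' : mat2 L) : det2 m' != 0 -> lin2 m' != 0.
  apply: contraNneq => E; have E' i : (lin2 m')`_i = 0 by rewrite E coef0.
  move: (E' 0) (E' 1); rewrite /lin2 !coefD !coefZ !coefX !coefC /= mulr1 mulr0 add0r addr0.
  rewrite /det2 => -> ->.
  by apply/eqP; ring.
have cop (m' : mat2 L) : det2 m' != 0 -> coprimep (lin1 m') (lin2 m').
  move=> m0'; apply/Pdiv.ClosedField.coprimepP => x /rootP E1; apply/eqP => E2.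
  have /eqP := evl m' x; rewrite E1 E2 eq_sym act_eq0 // xpair_eqE oner_eq0 andbF //.
have comp1 (m' : mat2 L) (A B : {poly L}) : det2 m' != 0 -> B != 0 ->
    ratcomp (fr m') (frac_of A / frac_of B) =
    frac_of (m'.1.1 *: A + m'.1.2 *: B) / frac_of (m'.2.1 *: A + m'.2.2 *: B).
  move=> m0' B0; rewrite (@ratcomp_frac _ 1) ?l2 ?cop ?size_lin //.
  have h1 (a b : L) : heval 1 (map_poly polyC (a *: 'X + b%:P)) A B = a *: A + b *: B.
    by rewrite rmorphD /= map_polyZ /= map_polyX map_polyC /= heval1_lin !mul_polyC.
  by rewrite !h1.
have am0 : det2 (adj2 m) != 0 by rewrite det2_adj2.
have scX (e : L) : e != 0 -> frac_of (e *: 'X) / frac_of e%:P = frac_of 'X.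
  move=> e0; rewrite -mul_polyC frac_ofM mulrAC divff ?mul1r //.
  by rewrite frac_of_eq0 polyC_eq0.
(* The inverse coordinate change comes from the adjugate; the conjugate is [cpoly1 / cpoly2], whose
   terms are over [k0] up to a common scalar. *)
exists (fr m), (fr (adj2 m)); split.
- have [u u0 [En Ed]] := ratnumden_frac (l2 _ m0) (cop _ m0).
  rewrite /ratdeg En Ed !size_scale //; apply/eqP; rewrite -eqSS prednK; last first.
    by rewrite leq_max !size_poly_gt0 l2 ?orbT.
  rewrite eqn_leq geq_max !size_lin /= leq_max.
  have : (m.1.1 != 0) || (m.2.1 != 0).
    rewrite -negb_and; apply: contra m0 => /andP[/eqP E1 /eqP E2].
    by rewrite /det2 E1 E2; apply/eqP; ring.
  have sz (a b : L) : a != 0 -> (1 < size (a *: 'X + b%:P)%R)%N.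
    move=> a0; rewrite ltnNge; apply: contra a0 => /leq_sizeP/(_ 1 isT).
    by rewrite coefD coefZ coefX coefC /= mulr1 addr0 => ->.
  by case/orP=> /sz H; rewrite H ?orbT.
- rewrite comp1 ?l2 // -(scX _ m0) /lin1 /lin2 /det2 /=; congr (frac_of _ / frac_of _).
    by rewrite -!mul_polyC !(polyCB, polyCN, polyCM); ring.
  by rewrite -!mul_polyC !(polyCB, polyCN, polyCM); ring.
- rewrite comp1 ?l2 // -(scX _ m0) /lin1 /lin2 /det2 /=; congr (frac_of _ / frac_of _).
    by rewrite -!mul_polyC !(polyCB, polyCN, polyCM); ring.
  by rewrite -!mul_polyC !(polyCB, polyCN, polyCM); ring.
rewrite {1}/ratmap -/P -/Q comp1 ?(Q_neq0 sP nd) //.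
set A := _ + _; set B := _ + _.
have AB v : fmap n.+1 A B v = act m (fmap n.+1 P Q v) by rewrite /fmap !hevalD !hevalZ.
have ndAB : nondeg n.+1 A B.
  move=> x y E1 E2; have := AB (x, y); rewrite {1}/fmap /= E1 E2 => /esym/eqP.
  rewrite act_eq0 //; have [[-> ->]//|xy] := eqVneq (x, y) (0, 0).
  by rewrite (negPf (fmap_neq0 nd xy)).
have sz (a b : L) : (size (a *: P + b *: Q)%R <= n.+2)%N.
  rewrite (leq_trans (size_polyD _ _)) // geq_max.
  by rewrite !(leq_trans (size_scale_leq _ _)).
have B0 : B != 0 := Q_neq0 (sz _ _) ndAB.
have cAB := nondeg_coprime (sz _ _) (sz _ _) ndAB.
rewrite (@ratcomp_frac _ n.+1) ?l2 ?sz //.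
have [p [q [e [e0 Ep Eq]]]] := chartmap_cpoly m0 mm.
have hA : heval n.+1 (map_poly polyC A) (lin1 (adj2 m)) (lin2 (adj2 m)) = cpoly1 n P Q m m.
  by rewrite /A rmorphD /= !map_polyZ hevalD !hevalZ /cpoly1 !mul_polyC.
have hB : heval n.+1 (map_poly polyC B) (lin1 (adj2 m)) (lin2 (adj2 m)) = cpoly2 n P Q m m.
  by rewrite /B rmorphD /= !map_polyZ hevalD !hevalZ /cpoly2 !mul_polyC.
have q0 : map_poly j q != 0.
  have : cpoly2 n P Q m m != 0.
    exact: Q_neq0 (size_cpoly1 n P Q m m) (cpoly_nondeg nd m0 m0).
  by apply: contraNneq => E; rewrite Eq E scaler0.
exists (map_poly j p), (map_poly j q); split=> // [i|i|].
- by rewrite coef_map; apply: jk.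
- by rewrite coef_map; apply: jk.
rewrite hA hB Ep Eq -!mul_polyC.
apply: (@eq_div_common _ _ _ _ _ (frac_of e%:P) 1); rewrite ?oner_eq0 ?mulr1 ?frac_ofM //.
by rewrite frac_of_eq0 polyC_eq0.
Qed.

(** * The field of constants and the dichotomy for preimages *)

Lemma const_emb_rmorphism (k : fieldType) (K : fieldExtType (ratfun k))
    (L : fieldType) (iota : {rmorphism K -> L}) :
  exists e : {rmorphism k -> L}, (e : k -> L) = const_emb iota.
Proof.
by exists (iota \o (in_alg K \o (@tofrac {poly k} \o polyC)) : {rmorphism k -> L}).
Qed.

(** An element algebraic over the constants is algebraic over [k] by transitivity of integrality. *)
Lemma kbar_field (k : fieldType) (K : fieldExtType (ratfun k))
    (L : fieldType) (iota : {rmorphism K -> L}) :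
  exists (k0 : fieldType) (j : {rmorphism k0 -> L}),
    (forall x, in_kbar iota x <-> exists c, x = j c) /\
    (forall (p : {poly k0}) x, p != 0 -> root (map_poly j p) x -> exists c, x = j c).
Proof.
have [e eE] := const_emb_rmorphism iota.
have inE x : in_kbar iota x <-> algebraicOver e x by rewrite /in_kbar -eE.
have [|x y|x y|k0 [j jP]] := @subfield_type L (in_kbar iota).
- by rewrite inE; apply: algebraic1.
- by rewrite !inE; apply: algebraic_sub.
- by rewrite !inE; apply: algebraic_div.
exists k0, j; split=> // p x p0 px; apply/jP; rewrite inE.
apply/integral_algebraic/(integral_root (p := map_poly j p)) => //.
  by rewrite map_poly_eq0.
move=> y /(nthP 0)[i _ <-]; apply/integral_algebraic; rewrite coef_map /=.
by apply/inE/jP; exists p`_i.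
Qed.

Theorem theorem2p1 (k : fieldType) (K : fieldExtType (ratfun k))
    (Kbar : closedFieldType) (iota : {rmorphism K -> Kbar})
    (HKbar : is_algebraic_closure iota)
    (phi : ratfun K) (d : nat) (Hdeg : ratdeg phi = d) (Hd : (2 <= d)%N)
    (Hphi : ~ isotrivial iota phi)
    (gamma : P1 K)
    (Hgamma : ~ postcritical (ratmap iota phi) (omap iota gamma)) :
  exists M : nat, forall m : nat, (M <= m)%N ->
    forall alpha : P1 Kbar,
      iter m (rateval (ratmap iota phi)) alpha = omap iota gamma ->
      (exists n : nat, alg_degree iota alpha n /\ (2 * n <= d ^ m)%N)
      \/
      (exists a1 a2 a3 a4 : P1 Kbar,
        [/\ Gal_conjugate iota alpha a1, Gal_conjugate iota alpha a2,
            Gal_conjugate iota alpha a3 & Gal_conjugate iota alpha a4]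
        /\ uniq [:: a1; a2; a3; a4]
        /\ ~ in_kbar iota (cross_ratio a1 a2 a3 a4)).
Proof.
(* Six is the exponent that the four descents of [orbit_constant_conjugate] require. Infinity has
   degree 1, and [2 <= d ^ m]. *)
exists 6 => m m6 [a|] fa; last first.
  left; exists 1%N; split; first exact: alg_degree_inf.
  rewrite muln1 (leq_trans Hd) // -{1}[d]expn1 leq_exp2l //.
  exact: leq_trans m6.
have [mp mpa] := minimal_poly_exists (HKbar a).
have [small|big] := leqP (2 * (size mp).-1) (d ^ m).
  by left; exists (size mp).-1; split=> //; apply: alg_degree_minimal.
right.
have [n n0 dE] : exists2 n, (0 < n)%N & d = n.+1 by case: (d) Hd => // n; exists n.
pose P := map_poly iota (ratnum phi); pose Q := map_poly iota (ratden phi).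
have sz : maxn (size P) (size Q) = n.+2.
  rewrite !size_map_poly -dE -Hdeg /ratdeg prednK //.
  by rewrite leq_max !size_poly_gt0 ratden_neq0 orbT.
have sP : (size P <= n.+2)%N by rewrite -sz leq_maxl.
have sQ : (size Q <= n.+2)%N by rewrite -sz leq_maxr.
have nd : nondeg n.+1 P Q.
  by apply: coprime_nondeg => //; rewrite coprimep_map rat_coprime.
have ncrit i : (i < m)%N ->
    ~ critical (ratmap iota phi) (iter i (rateval (ratmap iota phi)) (Some a)).
  move=> im ci; apply: Hgamma.
  exists (iter i (rateval (ratmap iota phi)) (Some a)), (m - i)%N.
  by split=> //; rewrite ?subn_gt0 // -iterD subnK // ltnW.
have mp'a := separable_preimage sP sQ nd fa ncrit mpa.
have [r [[ur sr ar rG] [rcl rtr]]] := separable_orbit HKbar mpa mp'a.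
(* Were the Wronskian zero, every point would be critical, in particular [Some a], and [gamma] would
   be post-critical. *)
have W0 : wronskian P Q != 0.
  apply/eqP => W0; apply: (ncrit 0%N); first exact: leq_trans m6.
  by apply: (@critical_of_wronskian _ n) => //; rewrite -/P -/Q W0 heval0.
have [k0 [j [jP rel_closed]]] := kbar_field iota.
(* If every cross-ratio of four distinct conjugates is constant, these conjugates form a good orbit,
   and [phi] becomes isotrivial. *)
apply: boolp.contrapT => noconj; apply: Hphi.
have GO : good_orbit iota j n (ratnum phi) (ratden phi) m (omap iota gamma) r.
  split=> //.
  - move=> b br; have [s [sK <-]] := rtr a b ar br.
    have it i : iter i (rateval (ratmap iota phi)) (Some (s a)) =
        omap s (iter i (rateval (ratmap iota phi)) (Some a)).
      elim: i => // i IHi; rewrite !iterS IHi.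
      exact: (rateval_K_fixing sP sQ nd).
    have := it m; rewrite fa => ->.
    by case: (gamma) => //= c; rewrite sK.
  - by rewrite -dE sr.
  move=> t1 t2 t3 t4 [T1 T2 T3 T4] ut; apply/jP; apply: boolp.contrapT => H.
  apply: noconj; exists (Some t1), (Some t2), (Some t3), (Some t4).
  split; first by split; apply: rG.
  split=> //; rewrite -(map_inj_uniq (@Some_inj _)) in ut; exact: ut.
have [M M0 MM] := orbit_constant_conjugate rel_closed n0 sP sQ nd m6 W0 GO.
apply: (isotrivial_of_chartmap sP sQ nd _ M0 MM) => c.
by apply/jP; exists c.
Qed.
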